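(* Let $\widetilde{\eta}:J(\mathbb{H})\to\mathbb{T}$ be the unique continuous monoid homomorphism with $\widetilde{\eta}\circ\sigma=\eta$, where $J(\mathbb{H})$ is the James reduced product of $(\mathbb{H},b_0)$. Then $\widetilde{\eta}_\#:\pi_1(J(\mathbb{H}),b_0)\to\pi_1(\mathbb{T},x_0)$ is an isomorphism; in particular $\pi_1(J(\mathbb{H}),b_0)\cong\mathbb{Z}^{\mathbb{N}}$.
   Context: $C_n\subset\mathbb{R}^2$ is the circle of radius $1/n$ centered at $(1/n,0)$, $\mathbb{H}=\bigcup_nC_n$ is the Hawaiian earring with basepoint $b_0=(0,0)$. $\mathbb{T}=\prod_{n\in\mathbb{N}}S^1$ is the infinite torus (a topological group) with identity $x_0$, and $\eta:\mathbb{H}\to\mathbb{T}$ is the embedding onto $\bigvee_nS^1$ sending $C_n$ homeomorphically onto the $n$-th circle factor; $\pi_1(\mathbb{T},x_0)\cong\mathbb{Z}^\mathbb{N}$. The James reduced product of a based space $(X,e)$ is $J(X)=\coprod_{n\in\mathbb{N}}X^n/\sim$ where $\sim$ is generated by deleting coordinates equal to $e$; elements are finite words in $X\setminus\{e\}$, with word concatenation as monoid operation. Topology: $X^n$ has the product topology, $J_n(X)$ (words of length $\leq n$) has the quotient topology from $q_n:X^n\to J_n(X)$, and $J(X)$ has the weak topology with respect to $\{J_n(X)\}$. $\sigma:X\to J(X)$ is the inclusion of one-letter words; every based map from $X$ to a topological monoid extends uniquely to a continuous monoid homomorphism on $J(X)$ through $\sigma$. *)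

(* Defs.v *)
From Stdlib Require Import Reals Lra List.
Open Scope R_scope.

Record space := Space { carrier :> Type; isopen : (carrier -> Prop) -> Prop }.

Definition cont (X Y : space) (f : X -> Y) : Prop :=
  forall U : Y -> Prop, isopen Y U -> isopen X (fun x => U (f x)).

Definition Rsp : space := Space R (fun U => forall x, U x ->
  exists eps, 0 < eps /\ forall y, Rabs (y - x) < eps -> U y).

Definition R2sp : space := Space (R * R)%type (fun U => forall p, U p ->
  exists eps, 0 < eps /\ forall q,
    (fst q - fst p) ^ 2 + (snd q - snd p) ^ 2 < eps ^ 2 -> U q).

Definition subsp (X : space) (P : X -> Prop) : space :=
  Space {x : X | P x} (fun U => exists V, isopen X V /\
     forall x : {x : X | P x}, U x <-> V (proj1_sig x)).

Definition prodsp (X Y : space) : space :=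
  Space (X * Y)%type (fun W => forall p, W p ->
    exists U V, isopen X U /\ isopen Y V /\ U (fst p) /\ V (snd p) /\
      forall q, U (fst q) -> V (snd q) -> W q).

(** Product topology on X^n, points of X^n being lists of length n:
    W is open iff each length-n point of W has a basic box neighbourhood
    U_1 x ... x U_n contained in W. *)
Definition listopen (X : space) (n : nat) (W : list X -> Prop) : Prop :=
  forall l : list X, length l = n -> W l ->
    exists Us : list (X -> Prop), Forall (isopen X) Us /\
      Forall2 (fun U x => U x) Us l /\
      forall l', Forall2 (fun U x => U x) Us l' -> W l'.

Definition Isp : space := subsp Rsp (fun t => 0 <= t <= 1).
Lemma I0_pf : 0 <= 0 <= 1. Proof. lra. Qed.
Lemma I1_pf : 0 <= 1 <= 1. Proof. lra. Qed.
Definition I0 : Isp := exist _ 0 I0_pf.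
Definition I1 : Isp := exist _ 1 I1_pf.

(** Based loops and homotopy of loops rel endpoints; pi_1(X,b) is the set
    of loops modulo [homotopic X b]. *)
Definition isloop (X : space) (b : X) (a : Isp -> X) : Prop :=
  cont Isp X a /\ a I0 = b /\ a I1 = b.

Definition homotopic (X : space) (b : X) (a a' : Isp -> X) : Prop :=
  exists Hm : prodsp Isp Isp -> X, cont (prodsp Isp Isp) X Hm /\
    forall s t : Isp, Hm (s, I0) = a s /\ Hm (s, I1) = a' s /\
                      Hm (I0, t) = b /\ Hm (I1, t) = b.

Definition oncircle (k : nat) (p : R * R) : Prop :=
  (fst p - / INR (S k)) ^ 2 + (snd p) ^ 2 = (/ INR (S k)) ^ 2.

Definition onH (p : R * R) : Prop := exists k, oncircle k p.

Definition Hsp : space := subsp R2sp onH.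

Lemma b0_onH : onH (0, 0).
Proof. exists 0%nat. unfold oncircle; simpl. field. Qed.
Definition b0 : Hsp := exist _ (0, 0) b0_onH.

Definition onS1 (p : R * R) : Prop := (fst p) ^ 2 + (snd p) ^ 2 = 1.
Definition S1sp : space := subsp R2sp onS1.

Lemma s1one_pf : onS1 (1, 0). Proof. unfold onS1; simpl; ring. Qed.
Definition s1one : S1sp := exist _ (1, 0) s1one_pf.

Lemma s1mul_pf (p q : R * R) : onS1 p -> onS1 q ->
  onS1 (fst p * fst q - snd p * snd q, fst p * snd q + snd p * fst q).
Proof.
  unfold onS1; simpl; intros Hp Hq.
  replace ((fst p * fst q - snd p * snd q) * ((fst p * fst q - snd p * snd q) * 1) +
   (fst p * snd q + snd p * fst q) * ((fst p * snd q + snd p * fst q) * 1))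
   with ((fst p * (fst p * 1) + snd p * (snd p * 1)) *
         (fst q * (fst q * 1) + snd q * (snd q * 1))) by ring.
  rewrite Hp, Hq; ring.
Qed.
Definition s1mul (z w : S1sp) : S1sp :=
  exist _ _ (s1mul_pf _ _ (proj2_sig z) (proj2_sig w)).

Definition Tsp : space := Space (nat -> S1sp) (fun W => forall z, W z ->
  exists (m : nat) (U : nat -> S1sp -> Prop),
    (forall i, (i < m)%nat -> isopen S1sp (U i) /\ U i (z i)) /\
    forall z', (forall i, (i < m)%nat -> U i (z' i)) -> W z').

Definition tmul (z w : Tsp) : Tsp := fun k => s1mul (z k) (w k).
Definition x0 : Tsp := fun _ => s1one.

(** The embedding etaH : H -> T: a point p = (x,y) of C_{k+1} goes to
    (1 - (k+1) x, (k+1) y) in factor k (this sends C_{k+1} homeomorphically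
    onto the k-th circle, with b0 |-> identity), and to 1 in other factors. *)
Lemma etaH_pf (k : nat) (p : R * R) : oncircle k p ->
  onS1 (1 - INR (S k) * fst p, INR (S k) * snd p).
Proof.
  unfold oncircle, onS1; cbn [fst snd]; intros h.
  assert (hc : INR (S k) <> 0) by (apply not_0_INR; discriminate).
  set (c := INR (S k)) in *.
  replace ((1 - c * fst p) ^ 2 + (c * snd p) ^ 2)
   with (c ^ 2 * ((fst p - / c) ^ 2 + snd p ^ 2)) by (field; exact hc).
  rewrite h. field. exact hc.
Qed.

Definition etaH (x : Hsp) : Tsp := fun k =>
  match Req_EM_T ((fst (proj1_sig x) - / INR (S k)) ^ 2 + (snd (proj1_sig x)) ^ 2)
                 ((/ INR (S k)) ^ 2) with
  | left h => exist _ _ (etaH_pf k (proj1_sig x) h)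
  | right _ => s1one
  end.

(** James reduced product J(H): finite words in H \ {b0}; monoid operation is
    concatenation (++), identity the empty word. *)
Definition Hstar : Type := {x : Hsp | proj1_sig x <> (0, 0)}.

Lemma is_origin_dec (p : R * R) : {p = (0, 0)} + {p <> (0, 0)}.
Proof.
  destruct p as [a b].
  destruct (Req_EM_T a 0) as [ha | ha]; destruct (Req_EM_T b 0) as [hb | hb].
  - left; subst; reflexivity.
  - right; intro e; inversion e; contradiction.
  - right; intro e; inversion e; contradiction.
  - right; intro e; inversion e; contradiction.
Defined.

Fixpoint reduce (l : list Hsp) : list Hstar :=
  match l with
  | nil => nil
  | x :: l' =>
      match is_origin_dec (proj1_sig x) with
      | left _ => reduce l'
      | right h => exist _ x h :: reduce l'
      end
  end.

(** Weak topology w.r.t. the J_n, each J_n carrying the quotient topology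
    from q_n : H^n -> J_n: U is open iff q_n^{-1}(U) is open in H^n for all n. *)
Definition Jsp : space := Space (list Hstar)
  (fun U => forall n : nat, listopen Hsp n (fun l => U (reduce l))).

Definition sigmaJ (x : Hsp) : Jsp := reduce (x :: nil).

Definition eJ : Jsp := nil.

(* Main.v *)
Require Import Defs.
From Stdlib Require Import Reals List.
From Stdlib Require Import Lra Lia.
From Stdlib Require Import Classical ClassicalEpsilon ProofIrrelevance FunctionalExtensionality.
Import ListNotations.

(** Deforming a loop in J(H).  Fix a circle C_k.  Each letter of C_k is pushed to the base
    point along the shorter arc; over a short time interval the only obstruction comes from
    letters crossing the point opposite to the base point, and each crossing leaves behind a full
    turn of C_k.  Since J(H) is a monoid, such a turn can be moved past any other path: contract
    that path's initial word to the empty word, run the turn, expand again.  Hence every loop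
    with letters in C_k, C_(k+1), ... is homotopic to some number m_k of turns of C_k followed by
    the same loop with the letters of C_k deleted, through words whose length is bounded
    independently of k.  The circles shrink to the base point, so these homotopies can be
    concatenated infinitely often, and the loop is homotopic to the one turning m_k times around
    C_k during [1 - 2^-k, 1 - 2^-(k+1)].  The numbers m_k are the winding numbers of the
    coordinates of the image in T, which gives injectivity; the loops with prescribed m_k give
    surjectivity. *)

(** Openness in J(H) is tested on each H^n separately, so an open set is only known to contain a
    [near]-ball among words of bounded length. Epsilon-delta estimates give continuity into J(H)
    once lengths are bounded; this is why every deformation carries a bound [n], and why the bound
    must depend neither on the number of subintervals nor on k. Pushing letters along the shorter
    arc is discontinuous at the opposite point, and since small letters may appear and vanish at any
    time, the letters of a path cannot be labelled globally. Near a given time, however, the large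
    letters can be followed one by one, and the small letters of C_k stay away from the opposite
    point. Subintervals are rejoined by prescribing how end points move: each end word is pushed by
    the shorter-arc rule. At a single time this rule is continuous in the deformation parameter,
    whatever the letters are. Moving a turn past a path is an Eckmann-Hilton exchange in which the
    second factor need not be a loop; contracting its initial word supplies the missing moment at
    which it is trivial. *)

(** * Epsilon-delta continuity *)

Class nearness (X : Type) := Nearness {
  nr : R -> X -> X -> Prop;
  nr_refl : forall e x, 0 < e -> nr e x x;
  nr_mono : forall d e x y, d <= e -> nr d x y -> nr e x y }.

(** Stated with a relation instead of a distance, since words only carry the relation [near].
    Domains are R and R * R rather than the interval and the square, so that formulas compose
    without side conditions; [clamp] brings parameters back into range. *)
Definition cnt {X Y : Type} `{nearness X} `{nearness Y} (F : X -> Y) : Prop :=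
  forall x e, 0 < e -> exists d, 0 < d /\ forall y, nr d x y -> nr e (F x) (F y).

#[global] Instance nearness_R : nearness R.
Proof.
  refine {| nr := fun e x y => Rabs (y - x) < e |}.
  - intros e x he. rewrite Rminus_diag, Rabs_R0; exact he.
  - intros d e x y hd h. lra.
Defined.

#[global] Instance nearness_prod (X Y : Type) `{nearness X} `{nearness Y} :
  nearness (X * Y).
Proof.
  refine {| nr := fun e p q => nr e (fst p) (fst q) /\ nr e (snd p) (snd q) |}.
  - intros e x he; split; apply nr_refl; assumption.
  - intros d e x y hd [h1 h2]; split; eapply nr_mono; eassumption.
Defined.

Definition nearness_via {X Y : Type} `{nearness Y} (i : X -> Y) : nearness X :=
  {| nr := fun e x y => nr e (i x) (i y);
     nr_refl := fun e x he => nr_refl e (i x) he;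
     nr_mono := fun d e x y hd h => nr_mono d e (i x) (i y) hd h |}.

#[global] Instance nearness_H : nearness Hsp :=
  nearness_via (fun x : Hsp => proj1_sig x : R * R).
#[global] Instance nearness_S1 : nearness S1sp :=
  nearness_via (fun x : S1sp => proj1_sig x : R * R).
#[global] Instance nearness_Hstar : nearness Hstar :=
  nearness_via (fun x : Hstar => proj1_sig x : Hsp).

Lemma cnt_const {X Y} `{nearness X} `{nearness Y} (c : Y) : cnt (fun _ : X => c).
Proof. intros x e he; exists 1; split; [lra|]. intros; apply nr_refl; exact he. Qed.

Lemma cnt_id {X} `{nearness X} : cnt (fun x : X => x).
Proof. intros x e he; exists e; split; auto. Qed.

Lemma cnt_comp {X Y Z} `{nearness X} `{nearness Y} `{nearness Z} (g : X -> Y) (F : Y -> Z) :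
  cnt F -> cnt g -> cnt (fun x => F (g x)).
Proof.
  intros hF hg x e he.
  destruct (hF (g x) e he) as [d [hd h1]]. destruct (hg x d hd) as [d' [hd' h2]].
  exists d'; split; auto.
Qed.

Lemma cnt_fst {X Y} `{nearness X} `{nearness Y} : cnt (fun p : X * Y => fst p).
Proof. intros x e he; exists e; split; auto. intros y hy; apply hy. Qed.

Lemma cnt_snd {X Y} `{nearness X} `{nearness Y} : cnt (fun p : X * Y => snd p).
Proof. intros x e he; exists e; split; auto. intros y hy; apply hy. Qed.

Lemma cnt_both {X Y Z} `{nearness X} `{nearness Y} `{nearness Z} (f : X -> Y) (g : X -> Z) :
  cnt f -> cnt g -> forall x e e', 0 < e -> 0 < e' ->
  exists d, 0 < d /\ forall y, nr d x y -> nr e (f x) (f y) /\ nr e' (g x) (g y).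
Proof.
  intros hf hg x e e' he he'.
  destruct (hf x e he) as [d [hd h1]]. destruct (hg x e' he') as [d' [hd' h2]].
  exists (Rmin d d'); split; [apply Rmin_pos; assumption|].
  intros y hy; split; [apply h1 | apply h2]; (eapply nr_mono; [|exact hy]).
  apply Rmin_l. apply Rmin_r.
Qed.

Lemma cnt_pair {X Y Z} `{nearness X} `{nearness Y} `{nearness Z} (f : X -> Y) (g : X -> Z) :
  cnt f -> cnt g -> cnt (fun x => (f x, g x)).
Proof. intros hf hg x e he. exact (cnt_both f g hf hg x e e he he). Qed.

Lemma cnt_ext {X Y} `{nearness X} `{nearness Y} (f g : X -> Y) :
  (forall x, f x = g x) -> cnt f -> cnt g.
Proof.
  intros E hf x e he. destruct (hf x e he) as [d [hd h]].
  exists d; split; auto. intros y hy; rewrite <- !E; auto.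
Qed.

(** Where [c] is nonzero only one branch occurs nearby; where it vanishes both branches start from
    the same value. Piecewise homotopies below are glued by this lemma. *)
Lemma cnt_paste {X Y} `{nearness X} `{nearness Y} (c : X -> R) (A B : X -> Y) :
  cnt c -> cnt A -> cnt B -> (forall x, c x = 0 -> A x = B x) ->
  cnt (fun x => if Rle_dec (c x) 0 then A x else B x).
Proof.
  intros hc hA hB E x e he.
  destruct (Rtotal_order (c x) 0) as [h|[h|h]].
  - destruct (cnt_both c A hc hA x (- c x) e ltac:(lra) he) as [d [hd h1]].
    exists d; split; auto. intros y hy. destruct (h1 y hy) as [h2 h3].
    apply Rabs_def2 in h2.
    destruct (Rle_dec (c x) 0), (Rle_dec (c y) 0); try lra. exact h3.
  - destruct (cnt_both A B hA hB x e e he he) as [d [hd h1]].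
    exists d; split; auto. intros y hy. destruct (h1 y hy) as [h2 h3].
    destruct (Rle_dec (c x) 0); try lra.
    destruct (Rle_dec (c y) 0); auto. rewrite (E x h); exact h3.
  - destruct (cnt_both c B hc hB x (c x) e ltac:(lra) he) as [d [hd h1]].
    exists d; split; auto. intros y hy. destruct (h1 y hy) as [h2 h3].
    apply Rabs_def2 in h2.
    destruct (Rle_dec (c x) 0), (Rle_dec (c y) 0); try lra. exact h3.
Qed.

Section RealValued.
Context {X : Type} `{nearness X}.
Implicit Types f g : X -> R.

Lemma cnt_plus f g : cnt f -> cnt g -> cnt (fun x => f x + g x).
Proof.
  intros hf hg x e he.
  destruct (cnt_both f g hf hg x (e/2) (e/2) ltac:(lra) ltac:(lra)) as [d [hd h1]].
  exists d; split; auto. intros y hy. destruct (h1 y hy) as [h2 h3].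
  cbn in *. apply Rabs_def2 in h2, h3. apply Rabs_def1; lra.
Qed.

Lemma cnt_opp f : cnt f -> cnt (fun x => - f x).
Proof.
  intros hf x e he. destruct (hf x e he) as [d [hd h1]].
  exists d; split; auto. intros y hy. specialize (h1 y hy).
  cbn in *. apply Rabs_def2 in h1. apply Rabs_def1; lra.
Qed.

Lemma cnt_minus f g : cnt f -> cnt g -> cnt (fun x => f x - g x).
Proof. intros hf hg. unfold Rminus. apply cnt_plus; [|apply cnt_opp]; assumption. Qed.

Lemma cnt_mult f g : cnt f -> cnt g -> cnt (fun x => f x * g x).
Proof.
  intros hf hg x e he.
  set (M := Rabs (f x) + Rabs (g x) + 1).
  assert (hM : 1 <= M) by (unfold M; pose proof (Rabs_pos (f x)); pose proof (Rabs_pos (g x)); lra).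
  set (e' := Rmin 1 (e / (2 * M))).
  assert (h2M : 0 < e / (2 * M)) by (apply Rdiv_lt_0_compat; lra).
  assert (he' : 0 < e') by (apply Rmin_pos; lra).
  destruct (cnt_both f g hf hg x e' e' he' he') as [d [hd h1]].
  exists d; split; auto. intros y hy. destruct (h1 y hy) as [h2 h3].
  cbn in *.
  replace (f y * g y - f x * g x)
    with ((f y - f x) * (g y - g x) + (f x * (g y - g x) + (f y - f x) * g x)) by ring.
  assert (ha : e' <= 1) by apply Rmin_l.
  assert (hb : e' * (2 * M) <= e).
  { apply Rle_trans with (e / (2 * M) * (2 * M)).
    apply Rmult_le_compat_r; [lra|apply Rmin_r]. right; field; lra. }
  eapply Rle_lt_trans; [apply Rabs_triang|].
  eapply Rle_lt_trans; [apply Rplus_le_compat_l, Rabs_triang|].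
  rewrite !Rabs_mult. unfold M in *.
  pose proof (Rabs_pos (f x)); pose proof (Rabs_pos (g x)).
  pose proof (Rabs_pos (f y - f x)); pose proof (Rabs_pos (g y - g x)).
  nra.
Qed.

Lemma cnt_Rmax f g : cnt f -> cnt g -> cnt (fun x => Rmax (f x) (g x)).
Proof.
  intros hf hg x e he.
  destruct (cnt_both f g hf hg x e e he he) as [d [hd h1]].
  exists d; split; auto. intros y hy. destruct (h1 y hy) as [h2 h3].
  cbn in *. apply Rabs_def2 in h2, h3.
  unfold Rmax. destruct (Rle_dec (f y) (g y)), (Rle_dec (f x) (g x)); apply Rabs_def1; lra.
Qed.

Lemma cnt_Rmin f g : cnt f -> cnt g -> cnt (fun x => Rmin (f x) (g x)).
Proof.
  intros hf hg. apply cnt_ext with (fun x => - Rmax (- f x) (- g x)).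
  - intros x. rewrite Ropp_Rmax, !Ropp_involutive. reflexivity.
  - apply cnt_opp, cnt_Rmax; apply cnt_opp; assumption.
Qed.

Lemma cnt_of_continuity (h : R -> R) f : continuity h -> cnt f -> cnt (fun x => h (f x)).
Proof.
  intros hh hf. apply (cnt_comp f h); [|exact hf].
  intros x e he. destruct (hh x e he) as [d [hd h1]].
  exists d; split; auto. intros y hy.
  (* The limit inside [continuity] ranges over points different from x, so equality is treated
     apart. *)
  destruct (Req_dec x y) as [->|n]; [apply nr_refl; exact he|].
  apply (h1 y). split; [split; [exact I|exact n]|exact hy].
Qed.

End RealValued.

Definition clamp (u v s : R) : R := Rmax u (Rmin v s).

Lemma clamp_in u v s : u <= v -> u <= clamp u v s <= v.
Proof. intros h. unfold clamp, Rmax, Rmin. destruct (Rle_dec v s), (Rle_dec u _); lra. Qed.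

Lemma clamp_id u v s : u <= s <= v -> clamp u v s = s.
Proof. intros h. unfold clamp, Rmax, Rmin. destruct (Rle_dec v s), (Rle_dec u _); lra. Qed.

Lemma clamp_lo u v s : u <= v -> s <= u -> clamp u v s = u.
Proof. intros h h'. unfold clamp, Rmax, Rmin. destruct (Rle_dec v s), (Rle_dec u _); lra. Qed.

Lemma clamp_hi u v s : u <= v -> v <= s -> clamp u v s = v.
Proof. intros h h'. unfold clamp, Rmax, Rmin. destruct (Rle_dec v s), (Rle_dec u _); lra. Qed.

Lemma cnt_clamp {X} `{nearness X} u v (f : X -> R) : cnt f -> cnt (fun x => clamp u v (f x)).
Proof. intros hf. apply cnt_Rmax; [apply cnt_const|]. apply cnt_Rmin; [apply cnt_const|exact hf]. Qed.

Lemma clamp_contract u v s s' : u <= v -> Rabs (clamp u v s' - clamp u v s) <= Rabs (s' - s).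
Proof.
  intros h. unfold clamp, Rmax, Rmin.
  destruct (Rle_dec v s), (Rle_dec v s');
    repeat match goal with |- context [Rle_dec ?a ?b] => destruct (Rle_dec a b) end;
    unfold Rabs; repeat match goal with |- context [Rcase_abs ?a] => destruct (Rcase_abs a) end; lra.
Qed.

Ltac cn1 :=
  first
  [ assumption
  | apply cnt_const | apply cnt_id | apply cnt_fst | apply cnt_snd
  | apply cnt_plus | apply cnt_minus | apply cnt_opp | apply cnt_mult
  | apply cnt_clamp | apply cnt_Rmax | apply cnt_Rmin | apply cnt_pair
  | match goal with
    | hF : cnt ?F |- cnt (fun x => ?F (@?g x)) => apply (cnt_comp g F hF)
    end ].
Ltac cn := unfold Rdiv; repeat cn1.

(* Heine-Borel in inductive form: a property of intervals that is additive and
   holds on all small intervals around each point holds on [0,1]. *)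
Lemma interval_induction (Q : R -> R -> Prop) :
  (forall u v w, u < v -> v < w -> Q u v -> Q v w -> Q u w) ->
  (forall s, 0 <= s <= 1 -> exists d, 0 < d /\
     forall u v, u < v -> 0 <= u -> v <= 1 -> s - d < u <= s -> s <= v < s + d -> Q u v) ->
  Q 0 1.
Proof.
  intros tr loc.
  set (E := fun x => 0 <= x <= 1 /\ (x = 0 \/ Q 0 x)).
  assert (b : bound E) by (exists 1; intros x [hx _]; lra).
  assert (ne : exists x, E x) by (exists 0; split; [lra|left; reflexivity]).
  destruct (completeness E b ne) as [c [up least]].
  assert (hc : 0 <= c <= 1).
  { split; [apply up; split; [lra|left; reflexivity]|].
    apply least. intros x [hx _]; lra. }
  destruct (loc c hc) as [d [hd hl]].
  assert (hx : exists x, E x /\ c - d < x <= c).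
  { apply NNPP; intro hn. assert (c <= c - d); [|lra].
    apply least. intros x Ex. destruct (Rle_or_lt x (c - d)); auto.
    exfalso; apply hn; exists x; auto. }
  destruct hx as [x [[hx0 hx1] hx2]].
  (* [c'] again lies in [E], hence does not exceed the supremum [c]; this forces c' = 1. *)
  set (c' := Rmin 1 (c + d / 2)).
  assert (hc' : c <= c' /\ c' < c + d /\ c' <= 1 /\ (c' = 1 \/ c < c')).
  { unfold c', Rmin. destruct (Rle_dec 1 (c + d/2)); repeat split; lra. }
  assert (hq : Q 0 c' \/ c' = 0).
  { destruct (Rlt_or_le x c') as [l|l].
    - left. assert (Q x c') by (apply hl; lra).
      destruct hx1 as [->|q]; auto. destruct (Req_dec x 0) as [->|n]; auto.
      apply tr with x; auto; lra.
    - assert (x = c') by lra. subst x. destruct hx1 as [h|h]; auto. }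
  assert (hE : E c').
  { split; [lra|]. destruct hq; auto. }
  apply up in hE.
  assert (c' = 1) by lra. rewrite H in hq. destruct hq; [auto|lra].
Qed.

(** * Words and one-letter words *)

Definition word : Type := list Hstar.

Lemma sig_ext {X : Type} (Q : X -> Prop) (x y : {x : X | Q x}) :
  proj1_sig x = proj1_sig y -> x = y.
Proof. destruct x as [x p], y as [y q]; cbn; intros ->. f_equal. apply proof_irrelevance. Qed.

Lemma Hsp_ext (x y : Hsp) : proj1_sig x = proj1_sig y -> x = y.
Proof. apply sig_ext. Qed.

Lemma Hstar_ext (x y : Hstar) : proj1_sig x = proj1_sig y -> x = y.
Proof. apply sig_ext. Qed.

Lemma S1_ext (x y : S1sp) : proj1_sig x = proj1_sig y -> x = y.
Proof. apply sig_ext. Qed.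

Lemma reduce_cons (x : Hsp) l : reduce (x :: l) = sigmaJ x ++ reduce l.
Proof.
  unfold sigmaJ. cbn [reduce app]. destruct (is_origin_dec _); reflexivity.
Qed.

Lemma sigmaJ_b0 : sigmaJ b0 = [].
Proof.
  unfold sigmaJ; cbn [reduce]. destruct (is_origin_dec _) as [e|n]; auto. contradiction n; reflexivity.
Qed.

Lemma sigmaJ_letter (x : Hstar) : sigmaJ (proj1_sig x) = [x].
Proof.
  unfold sigmaJ; cbn [reduce]. destruct (is_origin_dec _) as [e|n].
  - destruct (proj2_sig x e).
  - f_equal. apply Hstar_ext; reflexivity.
Qed.

Lemma sigmaJ_cases (p : Hsp) :
  p = b0 \/ exists x : Hstar, proj1_sig x = p.
Proof.
  destruct (is_origin_dec (proj1_sig p)) as [e|n].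
  - left. apply Hsp_ext. exact e.
  - right. exists (exist _ p n). reflexivity.
Qed.

(** * Angles *)

(** Angles are measured in full turns. *)
Definition circ (th : R) : R * R := (cos (2 * PI * th), sin (2 * PI * th)).

Lemma cos2_sin2 x : cos x * cos x + sin x * sin x = 1.
Proof. pose proof (sin2_cos2 x) as h. unfold Rsqr in h. lra. Qed.

Lemma circ_pf th : onS1 (circ th).
Proof. unfold onS1, circ; cbn. pose proof (cos2_sin2 (2 * PI * th)). lra. Qed.

Definition ee (th : R) : S1sp := exist _ (circ th) (circ_pf th).

Definition rad (j : nat) : R := / INR (S j).

Lemma rad_pos j : 0 < rad j.
Proof. apply Rinv_0_lt_compat, lt_0_INR; lia. Qed.

Lemma INR_rad j : INR (S j) * rad j = 1.
Proof. apply Rinv_r, not_0_INR; lia. Qed.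

(** Angle 0 is the base point, and the parametrization is chosen so that [etaH] sends angle [th] to
    [ee th] in factor j. *)
Definition ptR (j : nat) (th : R) : R * R :=
  (rad j * (1 - cos (2 * PI * th)), rad j * sin (2 * PI * th)).

Lemma ptR_on j th : oncircle j (ptR j th).
Proof.
  unfold oncircle, ptR; cbn [fst snd]. fold (rad j).
  pose proof (cos2_sin2 (2 * PI * th)). nra.
Qed.

Definition pt (j : nat) (th : R) : Hsp := exist _ (ptR j th) (ex_intro _ j (ptR_on j th)).

(* The one-letter word at angle [th] of the circle [j]; it is empty when [th] is an integer. *)
Definition P (j : nat) (th : R) : word := sigmaJ (pt j th).
Arguments P : simpl never.

(** The integers as a subset of R, given by the property in use: a shift of the angle by m does not
    move the point. Turn counts thus remain real numbers and enter formulas without coercions. *)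
Definition zint (m : R) : Prop := cos (2 * PI * m) = 1 /\ sin (2 * PI * m) = 0.

Lemma zint_cos m : cos (2 * PI * m) = 1 -> zint m.
Proof. intros h; split; auto. pose proof (cos2_sin2 (2 * PI * m)). nra. Qed.

Lemma zint_0 : zint 0.
Proof. apply zint_cos. rewrite Rmult_0_r. apply cos_0. Qed.

Lemma zint_1 : zint 1.
Proof. apply zint_cos. rewrite Rmult_1_r. apply cos_2PI. Qed.

Lemma circ_add_zint m th : zint m -> circ (th + m) = circ th.
Proof.
  intros [h1 h2]. unfold circ. rewrite Rmult_plus_distr_l, cos_plus, sin_plus, h1, h2.
  f_equal; ring.
Qed.

Lemma zint_add m m' : zint m -> zint m' -> zint (m + m').
Proof.
  intros h [h1 h2]. pose proof (circ_add_zint m m' h) as e.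
  unfold circ in e. injection e; intros e1 e2.
  rewrite Rplus_comm. split; lra.
Qed.

Lemma zint_opp m : zint m -> zint (- m).
Proof.
  intros [h1 h2]. apply zint_cos. rewrite Ropp_mult_distr_r_reverse, cos_neg. exact h1.
Qed.

Lemma zint_sub m m' : zint m -> zint m' -> zint (m - m').
Proof. intros h h'. apply zint_add; auto. apply zint_opp; auto. Qed.

Lemma pt_circ j th th' : circ th = circ th' -> pt j th = pt j th'.
Proof.
  intros e. injection e; intros e1 e2. apply Hsp_ext. cbn. unfold ptR. rewrite e1, e2. reflexivity.
Qed.

Lemma P_add_zint j m th : zint m -> P j (th + m) = P j th.
Proof. intros h. unfold P. f_equal. apply pt_circ, circ_add_zint, h. Qed.

Lemma pt_zint j m : zint m -> pt j m = b0.
Proof.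
  intros [h1 h2]. apply Hsp_ext. cbn. unfold ptR. rewrite h1, h2. f_equal; ring.
Qed.

Lemma P_zint j m : zint m -> P j m = [].
Proof. intros h. unfold P. rewrite pt_zint by exact h. apply sigmaJ_b0. Qed.

Lemma angle_exists c s : c * c + s * s = 1 -> exists th, 0 <= th < 1 /\ circ th = (c, s).
Proof.
  intros h.
  assert (hc : -1 <= c <= 1) by nra.
  pose proof PI_RGT_0 as hp.
  pose proof (acos_bound c) as hb.
  pose proof (cos_acos c hc) as h1. pose proof (sin_acos c hc) as h2.
  assert (hs : sqrt (1 - c²) = Rabs s).
  { rewrite <- sqrt_Rsqr_abs. f_equal. unfold Rsqr. lra. }
  rewrite hs in h2.
  destruct (Rle_or_lt 0 s) as [l|l].
  - exists (acos c / (2 * PI)). split.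
    + split. apply Rmult_le_pos; [lra|]. left; apply Rinv_0_lt_compat; lra.
      apply Rmult_lt_reg_r with (2 * PI); [lra|]. unfold Rdiv. rewrite Rmult_assoc, Rinv_l by lra. lra.
    + unfold circ. replace (2 * PI * (acos c / (2 * PI))) with (acos c) by (field; lra).
      rewrite h1, h2, Rabs_pos_eq; auto.
  - exists (1 - acos c / (2 * PI)). split.
    + assert (acos c <> 0). { intro e. rewrite e, sin_0 in h2. rewrite Rabs_left in h2; lra. }
      split.
      * apply Rmult_le_reg_r with (2 * PI); [lra|].
        replace ((1 - acos c / (2 * PI)) * (2 * PI)) with (2 * PI - acos c) by (field; lra). lra.
      * apply Rmult_lt_reg_r with (2 * PI); [lra|].
        replace ((1 - acos c / (2 * PI)) * (2 * PI)) with (2 * PI - acos c) by (field; lra). lra.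
    + unfold circ. replace (2 * PI * (1 - acos c / (2 * PI))) with (- acos c + 2 * PI) by (field; lra).
      rewrite cos_plus, sin_plus, cos_2PI, sin_2PI, cos_neg, sin_neg, h1, h2, Rabs_left; auto.
      f_equal; ring.
Qed.

Lemma letter_coords (x : Hstar) :
  exists jt : nat * R, 0 < snd jt < 1 /\ pt (fst jt) (snd jt) = proj1_sig x.
Proof.
  destruct x as [[[X Y] [j hj]] n]. cbn in n.
  unfold oncircle in hj. cbn [fst snd] in hj. fold (rad j) in hj.
  pose proof (INR_rad j) as hr. pose proof (rad_pos j) as hp.
  set (c := INR (S j)) in *.
  assert (e : (1 - c * X) * (1 - c * X) + (c * Y) * (c * Y) = 1).
  { replace ((1 - c * X) * (1 - c * X) + (c * Y) * (c * Y))
      with ((c * rad j - c * X) ^ 2 + (c * Y) ^ 2) by (rewrite hr; ring).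
    replace ((c * rad j - c * X) ^ 2 + (c * Y) ^ 2)
      with (c ^ 2 * ((X - rad j) ^ 2 + Y ^ 2)) by ring.
    rewrite hj. replace (c ^ 2 * rad j ^ 2) with ((c * rad j) ^ 2) by ring. rewrite hr; ring. }
  destruct (angle_exists _ _ e) as [th [ht E]].
  unfold circ in E; injection E; intros E1 E2.
  assert (Ept : ptR j th = (X, Y)).
  { unfold ptR. rewrite E1, E2. f_equal.
    transitivity ((c * rad j) * X); [ring|rewrite hr; ring].
    transitivity ((c * rad j) * Y); [ring|rewrite hr; ring]. }
  exists (j, th). cbn [fst snd]. split.
  - destruct (Req_dec th 0) as [->|]; [|lra].
    exfalso. apply n. rewrite <- Ept. unfold ptR. rewrite Rmult_0_r, cos_0, sin_0. f_equal; ring.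
  - apply Hsp_ext. cbn. exact Ept.
Qed.

(** Index and angle are chosen together. The index does not depend on the choice, because distinct
    circles meet only at the base point ([idx_unique]). *)
Definition coords (x : Hstar) : nat * R :=
  proj1_sig (constructive_indefinite_description _ (letter_coords x)).
Definition idx (x : Hstar) : nat := fst (coords x).
Definition ang (x : Hstar) : R := snd (coords x).

Lemma ang_range x : 0 < ang x < 1.
Proof. exact (proj1 (proj2_sig (constructive_indefinite_description _ (letter_coords x)))). Qed.

Lemma pt_coords x : pt (idx x) (ang x) = proj1_sig x.
Proof. exact (proj2 (proj2_sig (constructive_indefinite_description _ (letter_coords x)))). Qed.

Lemma P_coords x : P (idx x) (ang x) = [x].
Proof. unfold P. rewrite pt_coords. apply sigmaJ_letter. Qed.

Definition cx (x : Hstar) : R := fst (proj1_sig (proj1_sig x)).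
Definition cy (x : Hstar) : R := snd (proj1_sig (proj1_sig x)).

Lemma cx_coords x : cx x = rad (idx x) * (1 - cos (2 * PI * ang x)).
Proof. unfold cx. rewrite <- pt_coords. reflexivity. Qed.

Lemma cy_coords x : cy x = rad (idx x) * sin (2 * PI * ang x).
Proof. unfold cy. rewrite <- pt_coords. reflexivity. Qed.

Lemma letter_norm_pos x : 0 < cx x * cx x + cy x * cy x.
Proof.
  destruct (Req_dec (cx x) 0) as [e|]; [|nra].
  destruct (Req_dec (cy x) 0) as [e'|]; [|nra].
  exfalso. apply (proj2_sig x). unfold cx, cy in *.
  destruct (proj1_sig (proj1_sig x)); cbn in *; subst; reflexivity.
Qed.

(** In this form the index is read off from the point: j + 1 is the quotient of 2x by the squared
    norm, a continuous function away from the base point. Uniqueness and local constancy of the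
    index follow. *)
Lemma oncircle_eq j (x : Hstar) :
  oncircle j (proj1_sig (proj1_sig x)) ->
  INR (S j) * (cx x * cx x + cy x * cy x) = 2 * cx x.
Proof.
  unfold oncircle. fold (cx x) (cy x) (rad j). intros h.
  pose proof (INR_rad j) as hr.
  assert (E : cx x * cx x + cy x * cy x = 2 * rad j * cx x) by nra.
  rewrite E. transitivity (2 * (INR (S j) * rad j) * cx x); [ring|rewrite hr; ring].
Qed.

Lemma idx_oncircle x : oncircle (idx x) (proj1_sig (proj1_sig x)).
Proof. rewrite <- pt_coords. apply ptR_on. Qed.

Lemma INR_close i j N : 0 < N -> Rabs (INR (S i) * N - INR (S j) * N) < N -> i = j.
Proof.
  intros hN h. rewrite !S_INR in h. apply Rabs_def2 in h.
  assert (h1 : INR i - INR j < 1) by nra. assert (h2 : -1 < INR i - INR j) by nra.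
  destruct (Nat.lt_trichotomy i j) as [l|[l|l]]; auto; exfalso;
    apply le_INR in l; rewrite S_INR in l; lra.
Qed.

Lemma idx_unique j (x : Hstar) : oncircle j (proj1_sig (proj1_sig x)) -> idx x = j.
Proof.
  intros h. pose proof (oncircle_eq _ _ h) as e. pose proof (oncircle_eq _ _ (idx_oncircle x)) as e'.
  pose proof (letter_norm_pos x) as hp.
  apply (INR_close _ _ _ hp). rewrite e, e', Rminus_diag, Rabs_R0. exact hp.
Qed.

Lemma P_idx j th x : In x (P j th) -> idx x = j.
Proof.
  unfold P. intros hx. apply idx_unique.
  destruct (sigmaJ_cases (pt j th)) as [e|[y e]].
  - rewrite e, sigmaJ_b0 in hx. destruct hx.
  - rewrite <- e, sigmaJ_letter in hx. destruct hx as [->|[]]. rewrite e. apply ptR_on.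
Qed.

Lemma P_length j th : (length (P j th) <= 1)%nat.
Proof.
  unfold P. destruct (sigmaJ_cases (pt j th)) as [e|[y e]].
  - rewrite e, sigmaJ_b0; cbn; lia.
  - rewrite <- e, sigmaJ_letter; cbn; lia.
Qed.

(** * Small letters and nearness of words *)

Definition small (e : R) (x : Hstar) : Prop := nr e b0 (proj1_sig x).

Lemma small_iff e x : small e x <-> Rabs (cx x) < e /\ Rabs (cy x) < e.
Proof.
  unfold small, cx, cy; cbn. rewrite !Rminus_0_r. tauto.
Qed.

Lemma nr_letter_iff e (x y : Hstar) :
  nr e x y <-> Rabs (cx y - cx x) < e /\ Rabs (cy y - cy x) < e.
Proof. reflexivity. Qed.

Lemma cnt_cx : cnt cx.
Proof. intros x e he. exists e; split; auto. intros y [h _]; exact h. Qed.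

Lemma cnt_cy : cnt cy.
Proof. intros x e he. exists e; split; auto. intros y [_ h]; exact h. Qed.

Lemma cnt_pos {X} `{nearness X} (f : X -> R) x :
  cnt f -> 0 < f x -> exists d, 0 < d /\ forall y, nr d x y -> 0 < f y.
Proof.
  intros hf h. destruct (hf x (f x) h) as [d [hd h1]].
  exists d; split; auto. intros y hy. specialize (h1 y hy). cbn in h1.
  apply Rabs_def2 in h1. lra.
Qed.

Lemma not_small (x : Hstar) : exists e, 0 < e /\ ~ small e x.
Proof.
  destruct (Req_dec (cx x) 0) as [e|n].
  - exists (Rabs (cy x)). split.
    + apply Rabs_pos_lt. intro e'. pose proof (letter_norm_pos x). rewrite e, e' in *. lra.
    + rewrite small_iff. lra.
  - exists (Rabs (cx x)). split; [apply Rabs_pos_lt, n|]. rewrite small_iff. lra.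
Qed.

(** Turns closeness of points on a circle, known through the cosine of the difference of angles,
    into closeness of the angles; the last hypothesis excludes differences near a full turn. *)
Lemma cos_large d m : 0 < m <= PI -> cos m < cos d -> Rabs d <= 2 * PI - m -> Rabs d < m.
Proof.
  intros hm hc hd.
  assert (hc' : cos m < cos (Rabs d)).
  { unfold Rabs; destruct (Rcase_abs d); [rewrite cos_neg|]; exact hc. }
  pose proof (Rabs_pos d) as h0. set (a := Rabs d) in *.
  destruct (Rlt_or_le a m) as [l|l]; auto. exfalso.
  destruct (Rle_or_lt a PI) as [l'|l'].
  - assert (cos a <= cos m); [|lra]. apply cos_decr_1; lra.
  - assert (cos (2 * PI - a) <= cos m) as h by (apply cos_decr_1; lra).
    replace (2 * PI - a) with (- a + 2 * PI) in h by ring.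
    rewrite cos_plus, cos_2PI, sin_2PI, cos_neg in h. lra.
Qed.

Lemma cos_lt_1 m : 0 < m <= PI -> cos m < 1.
Proof. intros h. rewrite <- cos_0. apply cos_decreasing_1; lra. Qed.

Lemma coords_locally (x : Hstar) e : 0 < e ->
  exists d, 0 < d /\ forall y, nr d x y -> idx y = idx x /\ Rabs (ang y - ang x) < e.
Proof.
  intros he.
  pose proof PI_RGT_0 as hp. pose proof (ang_range x) as ha.
  set (j := idx x).
  (* If y lies on the circle i, then [q y] is (i - j) times the squared norm of y, so [f y] > 0 says
     that i and j differ by less than 1. *)
  set (q := fun y => 2 * cx y - INR (S j) * (cx y * cx y + cy y * cy y)).
  set (f := fun y => (cx y * cx y + cy y * cy y) - Rmax (q y) (- q y)).
  pose proof cnt_cx. pose proof cnt_cy.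
  assert (hq : cnt q) by (unfold q; cn).
  assert (hf : cnt f) by (unfold f; cn).
  assert (qx : q x = 0).
  { unfold q, j. rewrite (oncircle_eq _ _ (idx_oncircle x)). ring. }
  destruct (cnt_pos f x hf) as [d1 [hd1 h1]].
  { unfold f. rewrite qx, Ropp_0, Rmax_left by lra. pose proof (letter_norm_pos x). lra. }
  set (a := 2 * PI * ang x).
  assert (ha' : 0 < a < 2 * PI) by (unfold a; nra).
  (* The bounds by a and 2 PI - a ensure that every b in (0, 2 PI) satisfies |b - a| <= 2 PI - m, as
     [cos_large] requires. *)
  set (m := Rmin (Rmin (2 * PI * e) PI) (Rmin a (2 * PI - a))).
  assert (hm : 0 < m /\ m <= 2 * PI * e /\ m <= PI /\ m <= a /\ m <= 2 * PI - a).
  { assert (0 < 2 * PI * e) by nra. split; [repeat apply Rmin_pos; lra|].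
    pose proof (Rmin_l (2 * PI * e) PI). pose proof (Rmin_r (2 * PI * e) PI).
    pose proof (Rmin_l a (2 * PI - a)). pose proof (Rmin_r a (2 * PI - a)).
    pose proof (Rmin_l (Rmin (2 * PI * e) PI) (Rmin a (2 * PI - a))).
    pose proof (Rmin_r (Rmin (2 * PI * e) PI) (Rmin a (2 * PI - a))).
    unfold m; lra. }
  (* On the circle j this is cos (b - a) - cos m, with b the angle of y in radians; in Cartesian
     coordinates its continuity is evident. *)
  set (g := fun y => (1 - INR (S j) * cx y) * cos a + (INR (S j) * cy y) * sin a - cos m).
  assert (hg : cnt g) by (unfold g; cn).
  assert (zc : forall y, idx y = j -> 1 - INR (S j) * cx y = cos (2 * PI * ang y)
                                 /\ INR (S j) * cy y = sin (2 * PI * ang y)).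
  { intros y e1. rewrite cx_coords, cy_coords, e1. pose proof (INR_rad j) as hr. split.
    - transitivity (1 - (INR (S j) * rad j) * (1 - cos (2 * PI * ang y))); [ring|rewrite hr; ring].
    - transitivity ((INR (S j) * rad j) * sin (2 * PI * ang y)); [ring|rewrite hr; ring]. }
  destruct (cnt_pos g x hg) as [d2 [hd2 h2]].
  { unfold g. destruct (zc x eq_refl) as [-> ->]. fold a.
    pose proof (cos2_sin2 a). pose proof (cos_lt_1 m ltac:(lra)). lra. }
  exists (Rmin d1 d2). split; [apply Rmin_pos; auto|].
  intros y hy.
  assert (y1 : 0 < f y) by (apply h1; eapply nr_mono; [apply Rmin_l|exact hy]).
  assert (y2 : 0 < g y) by (apply h2; eapply nr_mono; [apply Rmin_r|exact hy]).
  assert (ei : idx y = j).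
  { apply (INR_close _ _ _ (letter_norm_pos y)).
    rewrite (oncircle_eq _ _ (idx_oncircle y)). fold (q y).
    unfold f in y1. pose proof (Rmax_l (q y) (- q y)). pose proof (Rmax_r (q y) (- q y)).
    apply Rabs_def1; lra. }
  split; [exact ei|].
  unfold g in y2. destruct (zc y ei) as [E1 E2]. rewrite E1, E2 in y2.
  pose proof (ang_range y) as hb.
  set (b := 2 * PI * ang y) in *.
  assert (hb' : 0 < b < 2 * PI) by (unfold b; nra).
  assert (Rabs (b - a) < m).
  { apply cos_large; [lra| |unfold Rabs; destruct (Rcase_abs _); lra].
    rewrite cos_minus. lra. }
  replace (b - a) with (2 * PI * (ang y - ang x)) in H1 by (unfold a, b; ring).
  rewrite Rabs_mult, (Rabs_pos_eq (2 * PI)) in H1 by lra.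
  apply Rmult_lt_reg_l with (2 * PI); lra.
Qed.

(** The first coordinate rad k * (1 - cos) bounds the angle away from the middle. The radius
    obtained depends on k. *)
Lemma ang_of_small k e : 0 < e ->
  exists d, 0 < d /\ forall x, small d x -> idx x = k -> ang x < e \/ 1 - e < ang x.
Proof.
  intros he. pose proof PI_RGT_0 as hp.
  set (m := Rmin (2 * PI * e) PI).
  assert (hm : 0 < m /\ m <= 2 * PI * e /\ m <= PI).
  { assert (0 < 2 * PI * e) by nra. split; [apply Rmin_pos; lra|].
    split; [apply Rmin_l|apply Rmin_r]. }
  pose proof (cos_lt_1 m ltac:(lra)) as h1.
  exists (rad k * (1 - cos m)). pose proof (rad_pos k) as hr. split; [nra|].
  intros x hx hk. apply small_iff in hx. destruct hx as [hx _]. apply Rabs_def2 in hx.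
  rewrite cx_coords, hk in hx. destruct hx as [hx _]. apply Rmult_lt_reg_l in hx; auto.
  pose proof (ang_range x) as ha. set (a := ang x) in *.
  assert (hp2 : 0 < 2 * PI * a) by nra.
  destruct (Rle_or_lt (2 * PI * a) (2 * PI - m)) as [l|l].
  - left. assert (h : Rabs (2 * PI * a) < m).
    { apply cos_large; [lra|lra|]. rewrite Rabs_pos_eq; lra. }
    rewrite Rabs_pos_eq in h by lra. nra.
  - right. nra.
Qed.

Lemma cnt_pt j : cnt (fun th => pt j th).
Proof.
  assert (h : cnt (fun th => (rad j * (1 - cos (2 * PI * th)), rad j * sin (2 * PI * th)))).
  { assert (c1 : cnt (fun th => 2 * PI * th)) by cn.
    pose proof (cnt_of_continuity cos _ continuity_cos c1).
    pose proof (cnt_of_continuity sin _ continuity_sin c1). cn. }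
  intros x e he. destruct (h x e he) as [d [hd h1]]. exists d; split; auto.
Qed.

Lemma cnt_ee {X} `{nearness X} (f : X -> R) : cnt f -> cnt (fun x => ee (f x)).
Proof.
  intros hf. apply (cnt_comp f ee); [|exact hf].
  assert (h : cnt (fun th => (cos (2 * PI * th), sin (2 * PI * th)))).
  { assert (c1 : cnt (fun th => 2 * PI * th)) by cn.
    pose proof (cnt_of_continuity cos _ continuity_cos c1).
    pose proof (cnt_of_continuity sin _ continuity_sin c1). cn. }
  intros x e he. destruct (h x e he) as [d [hd h1]]. exists d; split; auto.
Qed.

Lemma small_of_idx (e : R) : 0 < e -> exists K, forall x, (K <= idx x)%nat -> small e x.
Proof.
  intros he. destruct (archimed_cor1 (e / 3) ltac:(lra)) as [K [hK hK0]].
  exists K. intros x hx. apply small_iff. rewrite cx_coords, cy_coords.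
  assert (hr : rad (idx x) <= / INR K).
  { unfold rad. apply Rinv_le_contravar; [apply lt_0_INR; lia|apply le_INR; lia]. }
  pose proof (rad_pos (idx x)) as hp. set (r := rad (idx x)) in *.
  pose proof (COS_bound (2 * PI * ang x)). pose proof (SIN_bound (2 * PI * ang x)).
  split; apply Rabs_def1; nra.
Qed.

(* On words of bounded length this generates the topology of J(H): letters close to the base
   point may appear and disappear. *)
Inductive near (e : R) : word -> word -> Prop :=
| near_nil : near e [] []
| near_del x l l' : small e x -> near e l l' -> near e (x :: l) l'
| near_ins x l l' : small e x -> near e l l' -> near e l (x :: l')
| near_cons x y l l' : nr e x y -> near e l l' -> near e (x :: l) (y :: l').

Lemma small_mono d e x : d <= e -> small d x -> small e x.
Proof. unfold small. apply nr_mono. Qed.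

Lemma near_mono d e w w' : d <= e -> near d w w' -> near e w w'.
Proof.
  intros h. induction 1; [apply near_nil|apply near_del|apply near_ins|apply near_cons]; auto.
  - eapply small_mono; eassumption.
  - eapply small_mono; eassumption.
  - eapply nr_mono; eassumption.
Qed.

Lemma near_refl e w : 0 < e -> near e w w.
Proof. intros h. induction w; [apply near_nil|apply near_cons]; auto. apply nr_refl; auto. Qed.

#[global] Instance nearness_word : nearness word :=
  {| nr := near; nr_refl := near_refl; nr_mono := near_mono |}.

Lemma nr_letter_sym e (x y : Hstar) : nr e x y -> nr e y x.
Proof.
  rewrite !nr_letter_iff. intros [h1 h2]. rewrite Rabs_minus_sym in h1, h2. auto.
Qed.

Lemma nr_letter_trans d e (x y z : Hstar) : nr d x y -> nr e y z -> nr (d + e) x z.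
Proof.
  rewrite !nr_letter_iff. intros [h1 h2] [h3 h4].
  apply Rabs_def2 in h1, h2, h3, h4. split; apply Rabs_def1; lra.
Qed.

Lemma small_trans d e (x y : Hstar) : small d x -> nr e x y -> small (d + e) y.
Proof.
  rewrite !small_iff, !nr_letter_iff. intros [h1 h2] [h3 h4].
  apply Rabs_def2 in h1, h2, h3, h4. split; apply Rabs_def1; lra.
Qed.

Lemma near_sym e w w' : near e w w' -> near e w' w.
Proof.
  induction 1; [apply near_nil|apply near_ins|apply near_del|apply near_cons]; auto.
  apply nr_letter_sym; auto.
Qed.

(** Radii add because a letter that is within d of the base point and then moves by e is within d +
    e of it. The inner inductions skip the letters that the second relation inserts in front. *)
Lemma near_trans d e w w' w'' : 0 < d -> 0 < e -> near d w w' -> near e w' w'' -> near (d + e) w w''.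
Proof.
  intros hd he h. revert w''. induction h as [|x l l' hx h IH|x l l' hx h IH|x y l l' hx h IH]; intros w'' h'.
  - eapply near_mono; [|exact h']. lra.
  - apply near_del; auto. eapply small_mono; [|exact hx]; lra.
  - remember (x :: l') as v eqn:E. induction h'; try discriminate.
    + injection E as -> ->. auto.
    + apply near_ins; auto. eapply small_mono; [|eassumption]; lra.
    + injection E as -> ->. apply near_ins; auto. eapply small_trans; eassumption.
  - remember (y :: l') as v eqn:E. induction h'; try discriminate.
    + injection E as -> ->. apply near_del; auto. rewrite Rplus_comm.
      eapply small_trans; [eassumption|]. apply nr_letter_sym; auto.
    + apply near_ins; auto. eapply small_mono; [|eassumption]; lra.
    + injection E as -> ->. apply near_cons; auto. eapply nr_letter_trans; eassumption.
Qed.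

Lemma nr_letter_strict e (x y : Hstar) : nr e x y -> exists d, d < e /\ nr d x y.
Proof.
  rewrite nr_letter_iff. intros [h1 h2].
  set (m := Rmax (Rabs (cx y - cx x)) (Rabs (cy y - cy x))).
  assert (hm : m < e) by (apply Rmax_lub_lt; auto).
  exists ((m + e) / 2). split; [lra|]. rewrite nr_letter_iff.
  pose proof (Rmax_l (Rabs (cx y - cx x)) (Rabs (cy y - cy x))).
  pose proof (Rmax_r (Rabs (cx y - cx x)) (Rabs (cy y - cy x))).
  fold m in H, H0. lra.
Qed.

Lemma small_strict e (x : Hstar) : small e x -> exists d, d < e /\ small d x.
Proof.
  rewrite small_iff. intros [h1 h2].
  set (m := Rmax (Rabs (cx x)) (Rabs (cy x))).
  assert (hm : m < e) by (apply Rmax_lub_lt; auto).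
  exists ((m + e) / 2). split; [lra|]. rewrite small_iff.
  pose proof (Rmax_l (Rabs (cx x)) (Rabs (cy x))).
  pose proof (Rmax_r (Rabs (cx x)) (Rabs (cy x))).
  fold m in H, H0. lra.
Qed.

(** Only finitely many strict inequalities are involved, so some room is left. This makes
    [near]-balls open. *)
Lemma near_strict e w w' : 0 < e -> near e w w' -> exists d, 0 < d < e /\ near d w w'.
Proof.
  intros he. induction 1 as [|x l l' hx h [d [hd IH]]|x l l' hx h [d [hd IH]]|x y l l' hx h [d [hd IH]]].
  - exists (e / 2). split; [lra|constructor].
  - destruct (small_strict e x hx) as [d' [h1 h2]]. exists (Rmax d d').
    split; [split; [eapply Rlt_le_trans; [|apply Rmax_l]; lra|apply Rmax_lub_lt; lra]|].
    apply near_del; [eapply small_mono; [apply Rmax_r|auto]|eapply near_mono; [apply Rmax_l|auto]].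
  - destruct (small_strict e x hx) as [d' [h1 h2]]. exists (Rmax d d').
    split; [split; [eapply Rlt_le_trans; [|apply Rmax_l]; lra|apply Rmax_lub_lt; lra]|].
    apply near_ins; [eapply small_mono; [apply Rmax_r|auto]|eapply near_mono; [apply Rmax_l|auto]].
  - destruct (nr_letter_strict e x y hx) as [d' [h1 h2]]. exists (Rmax d d').
    split; [split; [eapply Rlt_le_trans; [|apply Rmax_l]; lra|apply Rmax_lub_lt; lra]|].
    apply near_cons; [eapply nr_mono; [apply Rmax_r|auto]|eapply near_mono; [apply Rmax_l|auto]].
Qed.

Lemma near_app e u v u' v' : near e u u' -> near e v v' -> near e (u ++ v) (u' ++ v').
Proof. intros h h'. induction h; cbn; auto; [apply near_del|apply near_ins|apply near_cons]; auto. Qed.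

Lemma near_split e u v w : near e (u ++ v) w ->
  exists u' v', w = u' ++ v' /\ near e u u' /\ near e v v'.
Proof.
  intros h. remember (u ++ v) as z eqn:E. revert u v E.
  induction h as [|x l l' hx h IH|x l l' hx h IH|x y l l' hx h IH]; intros u v E.
  - symmetry in E; apply app_eq_nil in E; destruct E as [-> ->].
    exists [], []; repeat constructor.
  - destruct u as [|z u].
    + cbn in E; subst v. destruct (IH [] l eq_refl) as [u' [v' [-> [h1 h2]]]].
      exists u', v'; repeat split; auto. apply near_del; auto.
    + injection E as -> E. destruct (IH u v E) as [u' [v' [-> [h1 h2]]]].
      exists u', v'; repeat split; auto. apply near_del; auto.
  - destruct (IH u v E) as [u' [v' [-> [h1 h2]]]].
    exists (x :: u'), v'; repeat split; auto. apply near_ins; auto.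
  - destruct u as [|z u].
    + cbn in E; subst v. destruct (IH [] l eq_refl) as [u' [v' [-> [h1 h2]]]].
      exists [], (y :: u' ++ v'); repeat split; [apply near_nil|apply near_cons; auto].
    + injection E as -> E. destruct (IH u v E) as [u' [v' [-> [h1 h2]]]].
      exists (y :: u'), v'; repeat split; auto. apply near_cons; auto.
Qed.

Lemma near_nil_iff e w : near e [] w <-> Forall (small e) w.
Proof.
  split.
  - intros h. remember [] as v eqn:E. induction h; try discriminate; constructor; auto.
  - induction 1; [apply near_nil|apply near_ins]; auto.
Qed.

Lemma near_small d e u w : 0 < d -> near e u w -> Forall (small d) u -> Forall (small (d + e)) w.
Proof.
  intros hd h. induction h; intros hu; auto.
  - inversion hu; auto.
  - constructor; auto. eapply small_mono; [|eassumption]; lra.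
  - inversion hu; constructor; auto. eapply small_trans; eauto.
Qed.

(** A letter that is not small cannot be deleted, so it has a partner, and only inserted letters can
    precede that partner. *)
Lemma near_cons_inv e x w l : ~ small e x -> near e (x :: w) l ->
  exists a y b, l = a ++ y :: b /\ Forall (small e) a /\ nr e x y /\ near e w b.
Proof.
  intros hn h. remember (x :: w) as v eqn:E.
  induction h as [|z l l' hx h IH|z l l' hx h IH|z y l l' hx h IH]; try discriminate.
  - injection E as -> ->. contradiction.
  - destruct (IH E) as [a [y [b [-> [h1 [h2 h3]]]]]].
    exists (z :: a), y, b; repeat split; auto; apply h2.
  - injection E as -> ->. exists [], y, l'; repeat split; auto; apply hx.
Qed.

Lemma cnt_app {X} `{nearness X} (f g : X -> word) :
  cnt f -> cnt g -> cnt (fun x => f x ++ g x).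
Proof.
  intros hf hg x e he. destruct (cnt_both f g hf hg x e e he he) as [d [hd h]].
  exists d; split; auto. intros y hy. destruct (h y hy). apply near_app; auto.
Qed.

Lemma near_sigmaJ e (p q : Hsp) : 0 < e -> nr e p q -> near e (sigmaJ p) (sigmaJ q).
Proof.
  intros he h. destruct (sigmaJ_cases p) as [->|[x <-]]; destruct (sigmaJ_cases q) as [->|[y <-]];
    rewrite ?sigmaJ_b0, ?sigmaJ_letter.
  - apply near_nil.
  - apply near_ins; [exact h|apply near_nil].
  - apply near_sym, near_ins; [|apply near_nil].
    destruct h as [h1 h2]. cbn in h1, h2. rewrite Rabs_minus_sym in h1, h2. split; assumption.
  - apply near_cons; [exact h|apply near_nil].
Qed.

Lemma cnt_P {X} `{nearness X} k (f : X -> R) : cnt f -> cnt (fun x => P k (f x)).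
Proof.
  intros hf. apply (cnt_comp f (P k)); [|exact hf].
  intros x e he. destruct (cnt_pt k x e he) as [d [hd h]].
  exists d; split; auto. intros y hy. apply near_sigmaJ; auto.
Qed.

Lemma cnt_single {X} `{nearness X} (f : X -> Hstar) : cnt f -> cnt (fun x => [f x]).
Proof.
  intros hf x e he. destruct (hf x e he) as [d [hd h]].
  exists d; split; auto. intros y hy. apply near_cons; [apply h; auto|constructor].
Qed.

Lemma forall_letters_radius (w : word) (Q : R -> Hstar -> Prop) :
  (forall d e x, 0 < d <= e -> Q e x -> Q d x) ->
  (forall x, In x w -> exists e, 0 < e /\ Q e x) ->
  exists e, 0 < e /\ forall x, In x w -> Q e x.
Proof.
  intros mono. induction w as [|x w IH]; intros h.
  - exists 1; split; [lra|]. intros x [].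
  - destruct IH as [e [he IH]]; [intros; apply h; right; auto|].
    destruct (h x (or_introl eq_refl)) as [e' [he' hx]].
    assert (hm : 0 < Rmin e e') by (apply Rmin_pos; auto).
    exists (Rmin e e'); split; auto.
    intros y [<-|hy]; [apply mono with e'|apply mono with e]; auto; split; auto.
    apply Rmin_r. apply Rmin_l.
Qed.

(** A letterwise operation is continuous if it is continuous at the letters present and sends
    letters near the base point to words near the empty one. *)
Lemma cnt_flat_map {D} `{nearness D} (A : D -> word) (g : D -> Hstar -> word) :
  cnt A ->
  (forall d0 x e, 0 < e -> In x (A d0) -> exists r, 0 < r /\
     forall d y, nr r d0 d -> nr r x y -> near e (g d0 x) (g d y)) ->
  (forall d0 e, 0 < e -> exists r, 0 < r /\
     forall d y, nr r d0 d -> small r y -> near e [] (g d y)) ->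
  cnt (fun d => flat_map (g d) (A d)).
Proof.
  intros hA hg hs d0 e he.
  (* The radius is also taken below the size of each letter of [A d0], so that none of them can
     disappear nearby. *)
  destruct (forall_letters_radius (A d0) (fun r x => ~ small r x /\
     forall d y, nr r d0 d -> nr r x y -> near e (g d0 x) (g d y))) as [r1 [hr1 h1]].
  - intros a b x [_ hab] [h h']; split.
    + intro hc; apply h; eapply small_mono; eassumption.
    + intros; apply h'; eapply nr_mono; eassumption.
  - intros x hx. destruct (hg d0 x e he hx) as [r [hr h]].
    destruct (not_small x) as [r' [hr' h']].
    exists (Rmin r r'). split; [apply Rmin_pos; auto|]. split.
    + intro hc; apply h'; eapply small_mono; [apply Rmin_r|exact hc].
    + intros; apply h; (eapply nr_mono; [apply Rmin_l|eassumption]).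
  - destruct (hs d0 e he) as [r2 [hr2 h2]].
    assert (hr : 0 < Rmin r1 r2) by (apply Rmin_pos; auto).
    destruct (hA d0 (Rmin r1 r2) hr) as [r3 [hr3 h3]].
    exists (Rmin (Rmin r1 r2) r3). split; [apply Rmin_pos; auto|].
    intros d hd.
    assert (hd12 : nr (Rmin r1 r2) d0 d) by (eapply nr_mono; [apply Rmin_l|exact hd]).
    assert (hd1 : nr r1 d0 d) by (eapply nr_mono; [apply Rmin_l|exact hd12]).
    assert (hd2 : nr r2 d0 d) by (eapply nr_mono; [apply Rmin_r|exact hd12]).
    assert (hn : near (Rmin r1 r2) (A d0) (A d)).
    { apply h3. eapply nr_mono; [apply Rmin_r|exact hd]. }
    revert h1 hn. generalize (A d0) (A d). clear - h2 hd1 hd2.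
    intros w w' h1 hn. induction hn as [|x l l' hx h IH|x l l' hx h IH|x y l l' hx h IH]; cbn.
    + constructor.
    + exfalso. apply (proj1 (h1 x (or_introl eq_refl))).
      eapply small_mono; [apply Rmin_l|exact hx].
    + change (flat_map (g d0) l) with ([] ++ flat_map (g d0) l). apply near_app.
      * apply h2; auto. eapply small_mono; [apply Rmin_r|exact hx].
      * apply IH; exact h1.
    + apply near_app.
      * apply (proj2 (h1 x (or_introl eq_refl))); auto.
        eapply nr_mono; [apply Rmin_l|exact hx].
      * apply IH. intros z hz. apply h1. right; auto.
Qed.

(** * Deleting a circle *)

Definition del (k : nat) (w : word) : word := filter (fun x => negb (Nat.eqb (idx x) k)) w.

Lemma del_flat_map k w : del k w = flat_map (fun x => if Nat.eqb (idx x) k then [] else [x]) w.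
Proof.
  induction w as [|x w IH]; auto. cbn. destruct (Nat.eqb (idx x) k); cbn; rewrite <- IH; auto.
Qed.

Lemma del_app k u v : del k (u ++ v) = del k u ++ del k v.
Proof. apply filter_app. Qed.

Lemma del_length k w : (length (del k w) <= length w)%nat.
Proof. apply filter_length_le. Qed.

Lemma cnt_del {D} `{nearness D} k (A : D -> word) : cnt A -> cnt (fun d => del k (A d)).
Proof.
  intros hA. eapply cnt_ext; [intros d; symmetry; apply del_flat_map|].
  apply (cnt_flat_map A (fun _ x => if Nat.eqb (idx x) k then [] else [x]) hA).
  - intros d0 x e he _. destruct (coords_locally x e he) as [r [hr h]].
    exists (Rmin e r). split; [apply Rmin_pos; auto|]. intros d y _ hy.
    destruct (h y) as [-> _]; [eapply nr_mono; [apply Rmin_r|exact hy]|].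
    destruct (Nat.eqb (idx x) k); [apply near_refl; auto|].
    apply near_cons; [|constructor]. eapply nr_mono; [apply Rmin_l|exact hy].
  - intros d0 e he. exists e; split; auto. intros d y _ hy.
    destruct (Nat.eqb (idx y) k); repeat constructor; apply hy.
Qed.

(** The length bound keeps deformations inside one J_n; the bound on indices makes the words small
    for large k, which the infinite concatenation uses. *)
Definition tail_word (k n : nat) (w : word) : Prop :=
  (length w <= n)%nat /\ forall x, In x w -> (k <= idx x)%nat.

Lemma tail_word_nil k n : tail_word k n [].
Proof. split; [cbn; lia|intros x []]. Qed.

Lemma tail_word_app k n n' u v : tail_word k n u -> tail_word k n' v -> tail_word k (n + n') (u ++ v).
Proof.
  intros [h1 h2] [h3 h4]. split; [rewrite length_app; lia|].
  intros x hx. apply in_app_or in hx. destruct hx; auto.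
Qed.

Lemma tail_word_mono k k' n n' w : (k' <= k)%nat -> (n <= n')%nat -> tail_word k n w -> tail_word k' n' w.
Proof.
  intros hk hn [h1 h2]. split; [lia|]. intros x hx. specialize (h2 x hx). lia.
Qed.

Lemma tail_word_P k th : tail_word k 1 (P k th).
Proof. split; [apply P_length|]. intros x hx. rewrite (P_idx _ _ _ hx). auto. Qed.

Lemma tail_word_del k n w : tail_word k n w -> tail_word (S k) n (del k w).
Proof.
  intros [h1 h2]. split; [pose proof (del_length k w); lia|].
  intros x hx. apply filter_In in hx. destruct hx as [hx hb]. specialize (h2 x hx).
  apply Bool.negb_true_iff, Nat.eqb_neq in hb. lia.
Qed.

Lemma tail_word_small e : 0 < e -> exists K, forall n w, tail_word K n w -> Forall (small e) w.
Proof.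
  intros he. destruct (small_of_idx e he) as [K hK]. exists K. intros n w [_ h].
  apply Forall_forall. intros x hx. apply hK, h, hx.
Qed.

Lemma small_near e u v : 0 < e -> Forall (small (e / 2)) u -> Forall (small (e / 2)) v -> near e u v.
Proof.
  intros he hu hv. replace e with (e / 2 + e / 2) by field.
  apply near_trans with []; try lra; [apply near_sym|]; apply near_nil_iff; auto.
Qed.

Ltac cn1 ::=
  first
  [ assumption
  | apply cnt_const | apply cnt_id | apply cnt_fst | apply cnt_snd
  | apply cnt_plus | apply cnt_minus | apply cnt_opp | apply cnt_mult
  | apply cnt_clamp | apply cnt_Rmax | apply cnt_Rmin | apply cnt_pair
  | apply cnt_app | apply cnt_P | apply cnt_del
  | match goal with
    | hF : cnt ?F |- cnt (fun x => ?F (@?g x)) => apply (cnt_comp g F)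
    end ].

(** * Moving a turn past a path *)

(** All angles decrease to 0. For a fixed word this is continuous in [l], but not jointly in the
    word: a letter of angle near 1 is close to the base point and yet travels almost the whole
    circle. Hence it is applied only to the fixed initial word of a path. *)
Definition shrink (l : R) (w : word) : word :=
  flat_map (fun x => P (idx x) ((1 - l) * ang x)) w.

Lemma shrink_0 w : shrink 0 w = w.
Proof.
  unfold shrink. induction w as [|x w IH]; cbn; auto. rewrite IH, Rminus_0_r, Rmult_1_l, P_coords.
  reflexivity.
Qed.

Lemma shrink_1 w : shrink 1 w = [].
Proof.
  unfold shrink. induction w as [|x w IH]; cbn; auto. rewrite IH, Rminus_diag, Rmult_0_l.
  rewrite P_zint by apply zint_0. reflexivity.
Qed.

Lemma cnt_shrink {X} `{nearness X} (f : X -> R) w : cnt f -> cnt (fun x => shrink (f x) w).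
Proof. intros hf. unfold shrink. induction w as [|x w IH]; cbn; cn. Qed.

Lemma tail_word_shrink k n l w : tail_word k n w -> tail_word k n (shrink l w).
Proof.
  intros [h1 h2]. split.
  - apply Nat.le_trans with (length w); auto. clear h1 h2. unfold shrink.
    induction w as [|x w IH]; cbn; auto. rewrite length_app.
    pose proof (P_length (idx x) ((1 - l) * ang x)). lia.
  - intros y hy. apply in_flat_map in hy. destruct hy as [x [hx hy]].
    rewrite (P_idx _ _ _ hy). auto.
Qed.

(* Contract the initial value of [W], run [psi] while the other factors are trivial, expand again. *)
Lemma commute_homotopy u v k n (W : R -> word) (phi psi : R -> R) :
  u < v -> cnt W -> cnt phi -> cnt psi ->
  zint (phi u) -> zint (phi v) -> zint (psi u) -> zint (psi v) ->
  (forall s, u <= s <= v -> tail_word k n (W s)) ->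
  exists L : R * R -> word, cnt L /\ forall s t, u <= s <= v ->
    (t <= 0 -> L (s, t) = P k (phi s) ++ W s ++ P k (psi s)) /\
    (1 <= t -> L (s, t) = P k (phi s + psi s) ++ W s) /\
    L (u, t) = W u /\ L (v, t) = W v /\ tail_word k (n + 2) (L (s, t)).
Proof.
  intros uv hW hphi hpsi pu pv qu qv hn.
  set (pos := fun x : R => u + clamp 0 1 x * (v - u)).
  assert (hpos : cnt pos) by (unfold pos; cn).
  assert (pos_in : forall x, u <= pos x <= v).
  { intros x. unfold pos. pose proof (clamp_in 0 1 x ltac:(lra)). nra. }
  assert (pos0 : forall x, x <= 0 -> pos x = u).
  { intros x hx. unfold pos. rewrite clamp_lo by lra. ring. }
  assert (pos1 : forall x, 1 <= x -> pos x = v).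
  { intros x hx. unfold pos. rewrite clamp_hi by lra. ring. }
  (* At stage t, the times up to t / 2 are spent on shrinking [W u] and restoring it; at t = 1 the
     word is empty on [1/8, 3/8]. Afterwards [W] is run with speed 1 + t, which reaches its end in
     time because (1 - t / 2)(1 + t) >= 1. *)
  set (G := fun p : R * R => if Rle_dec (fst p - snd p / 2) 0
              then shrink (clamp 0 1 (8 * Rmin (fst p) (snd p / 2 - fst p))) (W u)
              else W (pos ((fst p - snd p / 2) * (1 + snd p)))).
  assert (hG : cnt G).
  { unfold G. apply cnt_paste; [cn| |cn|].
    - apply cnt_shrink. cn.
    - intros [x t] e; cbn [fst snd] in *. rewrite e, Rmult_0_l, pos0 by lra.
      rewrite clamp_lo; [apply shrink_0|lra|].
      pose proof (Rmin_r x (t / 2 - x)). lra. }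
  assert (Gtail : forall p, tail_word k n (G p)).
  { intros p. unfold G. destruct (Rle_dec _ _).
    - apply tail_word_shrink, hn; lra.
    - apply hn, pos_in. }
  (* At t = 1, [psi] runs exactly on [1/8, 3/8], while the word is empty and [phi] still has its
     initial value; [phi] runs on [1/2, 1]. *)
  set (f1 := fun p : R * R => phi (pos ((1 - snd p) * fst p + snd p * (2 * fst p - 1)))).
  set (f2 := fun p : R * R => psi (pos ((1 - snd p) * fst p + snd p * (4 * fst p - / 2)))).
  assert (hf1 : cnt f1) by (unfold f1; cn).
  assert (hf2 : cnt f2) by (unfold f2; cn).
  set (loc := fun s : R => (s - u) * / (v - u)).
  assert (hloc : cnt loc) by (unfold loc; cn).
  assert (loc_in : forall s, u <= s <= v -> 0 <= loc s <= 1).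
  { intros s hs. unfold loc. assert (0 < / (v - u)) by (apply Rinv_0_lt_compat; lra).
    split; [apply Rmult_le_pos; lra|].
    apply Rmult_le_reg_r with (v - u); [lra|]. rewrite Rmult_assoc, Rinv_l; lra. }
  assert (pos_loc : forall s, u <= s <= v -> pos (loc s) = s).
  { intros s hs. unfold pos. rewrite clamp_id by auto. unfold loc. field. lra. }
  assert (loc_u : loc u = 0) by (unfold loc; ring).
  assert (loc_v : loc v = 1) by (unfold loc; field; lra).
  set (c1 := fun p : R * R => (loc (fst p), clamp 0 1 (2 * snd p))).
  set (c2 := fun p : R * R => (loc (fst p), clamp 0 1 (2 - 2 * snd p))).
  assert (hc1 : cnt c1) by (unfold c1; cn).
  assert (hc2 : cnt c2) by (unfold c2; cn).
  (* [M1] slides the factors apart and [M2], run backwards, returns with both angles in one factor.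
     They agree at t = 1: there either [f2] is an integer, or [f1] is an integer and the word
     between them is empty. *)
  set (M1 := fun p => P k (f1 p) ++ G p ++ P k (f2 p)).
  set (M2 := fun p => P k (f1 p + f2 p) ++ G p).
  assert (hM1 : cnt M1) by (unfold M1; cn).
  assert (hM2 : cnt M2) by (unfold M2; cn).
  assert (Z : forall c, c = phi u \/ c = phi v \/ c = psi u \/ c = psi v -> zint c).
  { intros c [->|[->|[->| ->]]]; auto. }
  assert (top : forall x, M1 (x, 1) = M2 (x, 1)).
  { intros x. unfold M1, M2.
    assert (hz : zint (f2 (x, 1)) \/ zint (f1 (x, 1)) /\ G (x, 1) = []).
    { unfold f1, f2; cbn [fst snd]. destruct (Rle_or_lt x (1 / 8)) as [l|l].
      - left. apply Z. rewrite pos0 by lra; auto.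
      - destruct (Rle_or_lt x (3 / 8)) as [l'|l'].
        + right. split; [apply Z; rewrite pos0 by lra; auto|].
          unfold G; cbn [fst snd]. destruct (Rle_dec _ _); [|lra].
          rewrite clamp_hi; [apply shrink_1|lra|]. unfold Rmin; destruct (Rle_dec _ _); lra.
        + left. apply Z. rewrite pos1 by lra; auto. }
    destruct hz as [hz|[hz ->]].
    - rewrite (P_zint _ _ hz), app_nil_r, P_add_zint; auto.
    - rewrite (P_zint _ _ hz), Rplus_comm, P_add_zint, app_nil_r; auto. }
  assert (G0 : forall t, 0 <= t <= 1 -> G (0, t) = W u).
  { intros t ht. unfold G; cbn [fst snd]. destruct (Rle_dec _ _); [|lra].
    rewrite clamp_lo; [apply shrink_0|lra|]. pose proof (Rmin_l 0 (t / 2 - 0)). lra. }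
  assert (G1 : forall t, 0 <= t <= 1 -> G (1, t) = W v).
  { intros t ht. unfold G; cbn [fst snd]. destruct (Rle_dec _ _); [lra|].
    rewrite pos1; auto. nra. }
  assert (Gb : forall s, u <= s <= v -> G (loc s, 0) = W s).
  { intros s hs. unfold G; cbn [fst snd]. pose proof (loc_in s hs). destruct (Rle_dec _ _).
    - assert (e : loc s = 0) by lra. rewrite e. rewrite <- (pos_loc s hs), e, (pos0 0) by lra.
      rewrite clamp_lo; [apply shrink_0|lra|]. pose proof (Rmin_l 0 (0 / 2 - 0)). lra.
    - replace ((loc s - 0 / 2) * (1 + 0)) with (loc s) by field. rewrite pos_loc; auto. }
  assert (fb : forall s, u <= s <= v -> f1 (loc s, 0) = phi s /\ f2 (loc s, 0) = psi s).
  { intros s hs. unfold f1, f2; cbn [fst snd].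
    replace ((1 - 0) * loc s + 0 * (2 * loc s - 1)) with (loc s) by ring.
    replace ((1 - 0) * loc s + 0 * (4 * loc s - / 2)) with (loc s) by ring.
    rewrite pos_loc; auto. }
  assert (zside : forall t, 0 <= t <= 1 ->
     zint (f1 (0, t)) /\ zint (f2 (0, t)) /\ zint (f1 (1, t)) /\ zint (f2 (1, t))).
  { intros t ht. unfold f1, f2; cbn [fst snd].
    split; [|split; [|split]]; apply Z;
      [rewrite pos0 by lra|rewrite pos0 by lra|rewrite pos1 by lra|rewrite pos1 by lra]; auto. }
  exists (fun p => if Rle_dec (snd p - / 2) 0 then M1 (c1 p) else M2 (c2 p)). split.
  { apply cnt_paste; [cn|cn|cn|]. intros [s t] e; cbn [fst snd] in *.
    unfold c1, c2; cbn [fst snd]. rewrite !clamp_hi by lra. apply top. }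
  intros s t hs. cbn [fst snd]. unfold c1, c2; cbn [fst snd].
  pose proof (clamp_in 0 1 (2 * t) ltac:(lra)) as h1.
  pose proof (clamp_in 0 1 (2 - 2 * t) ltac:(lra)) as h2.
  assert (A0 : forall t', 0 <= t' <= 1 -> M1 (0, t') = W u /\ M2 (0, t') = W u).
  { intros t' ht'. unfold M1, M2. rewrite (G0 t' ht'). destruct (zside t' ht') as [z1 [z2 _]].
    rewrite !P_zint; auto using zint_add. rewrite app_nil_r; auto. }
  assert (A1 : forall t', 0 <= t' <= 1 -> M1 (1, t') = W v /\ M2 (1, t') = W v).
  { intros t' ht'. unfold M1, M2. rewrite (G1 t' ht'). destruct (zside t' ht') as [_ [_ [z1 z2]]].
    rewrite !P_zint; auto using zint_add. rewrite app_nil_r; auto. }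
  assert (tM : forall p, tail_word k (n + 2) (M1 p) /\ tail_word k (n + 2) (M2 p)).
  { intros p. unfold M1, M2. split.
    - apply tail_word_mono with k (1 + (n + 1))%nat; [lia|lia|].
      repeat apply tail_word_app; auto using tail_word_P.
    - apply tail_word_mono with k (1 + n)%nat; [lia|lia|].
      repeat apply tail_word_app; auto using tail_word_P. }
  split; [|split; [|split; [|split]]].
  - intros ht. destruct (Rle_dec _ _); [|lra]. rewrite clamp_lo by lra.
    unfold M1. destruct (fb s hs) as [-> ->]. rewrite Gb; auto.
  - intros ht. destruct (Rle_dec _ _); [lra|]. rewrite clamp_lo by lra.
    unfold M2. destruct (fb s hs) as [-> ->]. rewrite Gb; auto.
  - rewrite loc_u. destruct (Rle_dec _ _); apply A0; auto.
  - rewrite loc_v. destruct (Rle_dec _ _); apply A1; auto.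
  - destruct (Rle_dec _ _); apply tM.
Qed.

(** * Splitting off the letters of one circle *)

Definition near_end (th : R) : R := if Rlt_dec th (1 / 2) then 0 else 1.

Lemma near_end_zint th : zint (near_end th).
Proof. unfold near_end. destruct (Rlt_dec _ _); [apply zint_0|apply zint_1]. Qed.

(* The cut is at angle 1/2: the turns of a letter around the circle are counted there. *)
Definition retract (k : nat) (t : R) (x : Hstar) : word :=
  if Nat.eqb (idx x) k
  then P k ((1 - clamp 0 1 t) * ang x + clamp 0 1 t * near_end (ang x)) else [x].

Definition rho (k : nat) (t : R) (w : word) : word := flat_map (retract k t) w.

Lemma rho_app k t u v : rho k t (u ++ v) = rho k t u ++ rho k t v.
Proof. apply flat_map_app. Qed.

Lemma rho_0 k t w : t <= 0 -> rho k t w = w.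
Proof.
  intros ht. unfold rho. induction w as [|x w IH]; cbn; auto. rewrite IH. unfold retract.
  destruct (Nat.eqb (idx x) k) eqn:E; auto. apply Nat.eqb_eq in E.
  rewrite clamp_lo by lra. rewrite Rminus_0_r, Rmult_1_l, Rmult_0_l, Rplus_0_r, <- E, P_coords.
  reflexivity.
Qed.

Lemma rho_1 k t w : 1 <= t -> rho k t w = del k w.
Proof.
  intros ht. rewrite del_flat_map. unfold rho. induction w as [|x w IH]; cbn; auto. rewrite IH.
  f_equal. unfold retract. destruct (Nat.eqb (idx x) k) eqn:E; auto.
  rewrite clamp_hi by lra. rewrite Rminus_diag, Rmult_0_l, Rmult_1_l, Rplus_0_l.
  apply P_zint, near_end_zint.
Qed.

Lemma retract_length k t x : (length (retract k t x) <= 1)%nat.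
Proof. unfold retract. destruct (Nat.eqb _ _); [apply P_length|cbn; auto]. Qed.

Lemma tail_word_rho k n t w : tail_word k n w -> tail_word k n (rho k t w).
Proof.
  intros [h1 h2]. split.
  - apply Nat.le_trans with (length w); auto. clear h1 h2. unfold rho.
    induction w as [|x w IH]; cbn; auto. rewrite length_app.
    pose proof (retract_length k t x). lia.
  - intros y hy. apply in_flat_map in hy. destruct hy as [x [hx hy]].
    unfold retract in hy. destruct (Nat.eqb (idx x) k) eqn:E.
    + rewrite (P_idx _ _ _ hy). auto.
    + destruct hy as [<-|[]]; auto.
Qed.

Lemma near_end_locally th : th <> 1 / 2 ->
  exists d, 0 < d /\ forall th', Rabs (th' - th) < d -> near_end th' = near_end th.
Proof.
  intros h. exists (Rabs (th - 1 / 2)). split; [apply Rabs_pos_lt; lra|].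
  intros th' h'. unfold near_end. apply Rabs_def2 in h'. unfold Rabs in h'.
  destruct (Rcase_abs _), (Rlt_dec th (1/2)), (Rlt_dec th' (1/2)); auto; lra.
Qed.

Lemma P_near_nil k e : 0 < e -> exists d, 0 < d /\ forall th,
  Rabs th < d \/ Rabs (th - 1) < d -> near e [] (P k th).
Proof.
  intros he. assert (hP : cnt (fun th => P k th)) by cn.
  destruct (hP 0 e he) as [d [hd h]]. destruct (hP 1 e he) as [d' [hd' h']].
  rewrite P_zint in h by apply zint_0. rewrite P_zint in h' by apply zint_1.
  exists (Rmin d d'). split; [apply Rmin_pos; auto|]. intros th [l|l].
  - apply h. cbn. rewrite Rminus_0_r. eapply Rlt_le_trans; [exact l|apply Rmin_l].
  - apply h'. cbn. eapply Rlt_le_trans; [exact l|apply Rmin_r].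
Qed.

(** [near_end] is locally constant away from 1/2, so the push is continuous at every letter met by
    the path. A letter near the base point is pushed towards the end it is already close to, so it
    stays near the base point. *)
Lemma cnt_rho k (a : R -> word) :
  cnt a -> (forall s x, In x (a s) -> idx x = k -> ang x <> 1 / 2) ->
  cnt (fun p : R * R => rho k (snd p) (a (fst p))).
Proof.
  intros ha hmid.
  apply (cnt_flat_map (fun p : R * R => a (fst p)) (fun p x => retract k (snd p) x)); [cn| |].
  - intros [s0 t0] x e he hx. cbn [fst snd] in *.
    destruct (Nat.eq_dec (idx x) k) as [E|E].
    + destruct (near_end_locally (ang x) (hmid s0 x hx E)) as [d1 [hd1 h1]].
      assert (hF : cnt (fun q : R * R => P k ((1 - clamp 0 1 (fst q)) * snd q + clamp 0 1 (fst q) * near_end (ang x)))) by cn.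
      destruct (hF (t0, ang x) e he) as [d2 [hd2 h2]].
      destruct (coords_locally x (Rmin d1 d2) ltac:(apply Rmin_pos; auto)) as [d3 [hd3 h3]].
      exists (Rmin d2 d3). split; [apply Rmin_pos; auto|]. intros [s t] y [_ ht] hy. cbn [fst snd] in *.
      destruct (h3 y) as [E' hang]; [eapply nr_mono; [apply Rmin_r|exact hy]|].
      unfold retract. rewrite E', E, Nat.eqb_refl.
      rewrite (h1 (ang y)) by (eapply Rlt_le_trans; [exact hang|apply Rmin_l]).
      apply (h2 (t, ang y)). split; cbn [fst snd].
      * eapply nr_mono; [apply Rmin_l|exact ht].
      * eapply Rlt_le_trans; [exact hang|apply Rmin_r].
    + destruct (coords_locally x 1 ltac:(lra)) as [d3 [hd3 h3]].
      exists (Rmin e d3). split; [apply Rmin_pos; auto|]. intros [s t] y _ hy. cbn [fst snd] in *.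
      destruct (h3 y) as [E' hang]; [eapply nr_mono; [apply Rmin_r|exact hy]|].
      unfold retract. rewrite E'. apply Nat.eqb_neq in E. rewrite E.
      apply near_cons; [eapply nr_mono; [apply Rmin_l|exact hy]|apply near_nil].
  - intros [s0 t0] e he. destruct (P_near_nil k e he) as [d [hd h]].
    (* The bound 1/2 makes [near_end] select the end that the angle is close to. *)
    destruct (ang_of_small k (Rmin d (1 / 2)) ltac:(apply Rmin_pos; lra)) as [r [hr h']].
    exists (Rmin e r). split; [apply Rmin_pos; auto|]. intros [s t] y _ hy. cbn [snd].
    unfold retract. destruct (Nat.eqb (idx y) k) eqn:E.
    + apply Nat.eqb_eq in E. apply h.
      pose proof (clamp_in 0 1 t ltac:(lra)) as hc. set (c := clamp 0 1 t) in *.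
      pose proof (ang_range y) as hy1. pose proof (Rmin_l d (1/2)). pose proof (Rmin_r d (1/2)).
      destruct (h' y) as [l|l]; auto; [eapply small_mono; [apply Rmin_r|exact hy]| |];
        unfold near_end; destruct (Rlt_dec _ _); try lra; [left|right]; apply Rabs_def1; nra.
    + apply near_ins; [eapply small_mono; [apply Rmin_l|exact hy]|apply near_nil].
Qed.

(* The path [a] over [u,v] deforms to the product of a loop in the circle [k] and the path
   with all letters of that circle deleted, the end points moving by [rho].
   [n] bounds the lengths of the words occurring in the deformation. *)
Definition splits (k n : nat) (u v : R) (a : R -> word) : Prop :=
  exists (phi : R -> R) (F : R * R -> word) (T : R),
    1 <= T /\ cnt phi /\ cnt F /\ zint (phi u) /\ zint (phi v) /\
    forall s, u <= s <= v -> (length (a s) < n)%nat /\ forall t,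
      (t <= 0 -> F (s, t) = a s) /\
      (T <= t -> F (s, t) = P k (phi s) ++ del k (a s)) /\
      F (u, t) = rho k t (a u) /\ F (v, t) = rho k t (a v) /\
      tail_word k n (F (s, t)).

Lemma splits_ext k n u v a a' :
  u <= v -> (forall s, u <= s <= v -> a s = a' s) -> splits k n u v a -> splits k n u v a'.
Proof.
  intros uv E [phi [F [T [hT [h1 [h2 [h3 [h4 h5]]]]]]]].
  exists phi, F, T. repeat (split; [assumption|]). intros s hs.
  rewrite <- !E by lra. auto.
Qed.

Lemma splits_mono k n n' u v a : (n <= n')%nat -> splits k n u v a -> splits k n' u v a.
Proof.
  intros hn [phi [F [T [hT [h1 [h2 [h3 [h4 h5]]]]]]]].
  exists phi, F, T. repeat (split; [assumption|]). intros s hs.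
  destruct (h5 s hs) as [h6 h7]. split; [lia|]. intros t. destruct (h7 t) as [g1 [g2 [g3 [g4 g5]]]].
  repeat (split; [assumption|]). eapply tail_word_mono; [| |exact g5]; auto.
Qed.

(** The deformations agree at [v] since both are prescribed there to be [rho]. The angles there are
    integers, so shifting the left one by their difference makes the angle functions agree without
    changing any word. *)
Lemma splits_join k n u v w a :
  u < v -> v < w -> splits k n u v a -> splits k n v w a -> splits k n u w a.
Proof.
  intros uv vw [phi [F [T [hT [h1 [h2 [h3 [h4 h5]]]]]]]] [phi' [F' [T' [hT' [h1' [h2' [h3' [h4' h5']]]]]]]].
  set (c := phi' v - phi v).
  assert (hc : zint c) by (apply zint_sub; auto).
  exists (fun s => if Rle_dec (s - v) 0 then phi s + c else phi' s).
  exists (fun p => if Rle_dec (fst p - v) 0 then F p else F' p).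
  exists (Rmax T T'). split; [eapply Rle_trans; [exact hT|apply Rmax_l]|]. split; [|split; [|split; [|split]]].
  - apply cnt_paste; [cn|cn|cn|]. intros x e. replace x with v by lra. unfold c; ring.
  - apply cnt_paste; [cn|cn|cn|]. intros [x t] e. cbn [fst] in e. replace x with v by lra.
    transitivity (rho k t (a v)); [apply (h5 v); lra|symmetry; apply (h5' v); lra].
  - destruct (Rle_dec _ _); [|lra]. apply zint_add; auto.
  - destruct (Rle_dec _ _); [lra|]. auto.
  - intros s hs. split.
    + destruct (Rle_or_lt s v); [apply h5|apply h5']; lra.
    + intros t. cbn [fst].
      assert (ha : T <= Rmax T T') by apply Rmax_l. assert (hb : T' <= Rmax T T') by apply Rmax_r.
      split; [|split; [|split; [|split]]].
      * intros ht. destruct (Rle_dec _ _); [apply h5|apply h5']; lra.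
      * intros ht. destruct (Rle_dec _ _).
        -- rewrite P_add_zint by exact hc. apply h5; lra.
        -- apply h5'; lra.
      * destruct (Rle_dec _ _); [apply (h5 u); lra|lra].
      * destruct (Rle_dec _ _); [lra|apply (h5' w); lra].
      * destruct (Rle_dec _ _); [apply h5|apply h5']; lra.
Qed.

(** Deforming both factors at once ends in turn, rest, turn, rest; [commute_homotopy] then moves the
    second turn past the first rest. The ends do not move during this extra stage, because after
    time 1 [rho] is constantly the deletion. *)
Lemma splits_app k n n' u v a b : u < v -> cnt a -> cnt b ->
  splits k n u v a -> splits k n' u v b -> splits k (n + n') u v (fun s => a s ++ b s).
Proof.
  intros uv ha hb [phi [F [T [hT [h1 [h2 [h3 [h4 h5]]]]]]]] [phi' [F' [T' [hT' [h1' [h2' [h3' [h4' h5']]]]]]]].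
  assert (tla : forall s, u <= s <= v -> tail_word k (n - 1) (a s)).
  { intros s hs. destruct (h5 s hs) as [l h]. destruct (h 0) as [e [_ [_ [_ [_ h6]]]]].
    rewrite e in h6 by lra. split; [lia|exact h6]. }
  assert (tlb : forall s, u <= s <= v -> tail_word k (n' - 1) (b s)).
  { intros s hs. destruct (h5' s hs) as [l h]. destruct (h 0) as [e [_ [_ [_ [_ h6]]]]].
    rewrite e in h6 by lra. split; [lia|exact h6]. }
  assert (td : forall m w, tail_word k m w -> tail_word k m (del k w)).
  { intros m w hw. apply tail_word_mono with (S k) m; auto. apply tail_word_del; auto. }
  destruct (commute_homotopy u v k (n - 1) (fun s => del k (a s)) phi phi') as [L [hL LL]]; auto; [cn|].
  set (M := Rmax T T'). assert (hM : T <= M) by apply Rmax_l. assert (hM' : T' <= M) by apply Rmax_r.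
  exists (fun s => phi s + phi' s).
  (* The two stages are known to agree only over [u, v]; clamping makes the glued map continuous on
     the whole plane. *)
  set (cl := fun p : R * R => clamp u v (fst p)).
  assert (hcl : cnt cl) by (unfold cl; cn).
  assert (E : forall s, u <= s <= v -> F (s, M) ++ F' (s, M) = L (s, M - M) ++ del k (b s)).
  { intros s hs. replace (M - M) with 0 by ring. destruct (LL s 0 hs) as [-> _]; [|lra].
    destruct (h5 s hs) as [_ g]. destruct (g M) as [_ [-> _]]; [|lra].
    destruct (h5' s hs) as [_ g']. destruct (g' M) as [_ [-> _]]; [|lra].
    rewrite <- !app_assoc. reflexivity. }
  exists (fun p => if Rle_dec (snd p - M) 0 then F (cl p, snd p) ++ F' (cl p, snd p)
                   else L (cl p, snd p - M) ++ del k (b (cl p))).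
  exists (M + 1). split; [lra|]. split; [cn|]. split; [|split; [|split]].
  - apply cnt_paste; [cn|cn|cn|]. intros [s t] e. cbn [snd] in *. replace t with M by lra.
    apply E. apply clamp_in; lra.
  - apply zint_add; auto.
  - apply zint_add; auto.
  - intros s hs. destruct (h5 s hs) as [l g]. destruct (h5' s hs) as [l' g']. split.
    + rewrite length_app. lia.
    + intros t. unfold cl. cbn [fst snd]. rewrite !clamp_id by lra.
      destruct (g t) as [g1 [g2 [g3 [g4 g5]]]]. destruct (g' t) as [g1' [g2' [g3' [g4' g5']]]].
      destruct (LL s (t - M) hs) as [L1 [L2 [L3 [L4 L5]]]].
      rewrite !rho_app.
      split; [|split; [|split; [|split]]].
      * intros ht. destruct (Rle_dec _ _); [|lra]. rewrite g1, g1'; auto.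
      * intros ht. destruct (Rle_dec _ _); [lra|]. rewrite L2 by lra. rewrite del_app, app_assoc. auto.
      * destruct (Rle_dec _ _); [rewrite g3, g3'; auto|]. rewrite L3, !rho_1 by lra. auto.
      * destruct (Rle_dec _ _); [rewrite g4, g4'; auto|]. rewrite L4, !rho_1 by lra. auto.
      * destruct (Rle_dec _ _); [apply tail_word_app; auto|].
        (* The strict length bounds in [splits] pay for the two letters added by the commutation, so
           the bounds simply add up. *)
        apply tail_word_mono with k ((n - 1 + 2) + (n' - 1))%nat; [lia|lia|].
        apply tail_word_app; auto.
Qed.

(** No letter meets the cut, so [rho] itself is the deformation and no turn remains. *)
Lemma splits_small k n u v a : cnt a -> (forall s, tail_word k n (a s)) ->
  (forall s x, In x (a s) -> idx x = k -> ang x <> 1 / 2) -> splits k (S n) u v a.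
Proof.
  intros ha ht hmid.
  exists (fun _ => 0), (fun p => rho k (snd p) (a (fst p))), 1.
  split; [lra|]. split; [cn|]. split; [apply cnt_rho; auto|].
  split; [apply zint_0|]. split; [apply zint_0|].
  intros s _. split; [specialize (ht s); destruct ht; lia|]. intros t. cbn [fst snd].
  split; [apply rho_0|]. split; [intros h; rewrite rho_1, (P_zint k 0) by (auto; apply zint_0); auto|].
  split; [auto|]. split; [auto|].
  apply tail_word_mono with k n; [lia|lia|]. apply tail_word_rho, ht.
Qed.

(** A letter never reaches the base point, so on the circle k its angle is a continuous function
    with values in (0, 1). It is deformed linearly to the affine function joining the ends nearest
    to its initial and final values; a net crossing of the cut becomes a full turn. On other circles
    nothing moves. *)
Lemma splits_letter k u v (y : R -> Hstar) j :
  u < v -> cnt y -> (forall s, idx (y s) = j) -> (k <= j)%nat -> splits k 2 u v (fun s => [y s]).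
Proof.
  intros uv hy hj kj.
  assert (tl : forall s, tail_word k 2 [y s]).
  { intros s. split; [cbn; lia|]. intros x [<-|[]]. rewrite hj; auto. }
  destruct (Nat.eq_dec j k) as [->|n].
  - set (th := fun s => ang (y s)).
    assert (hth : cnt th).
    { intros s e he. destruct (coords_locally (y s) e he) as [d [hd h]].
      destruct (hy s d hd) as [d' [hd' h']]. exists d'; split; auto.
      intros s' hs'. apply (h (y s')). apply h'; auto. }
    set (e0 := near_end (th u)). set (e1 := near_end (th v)).
    set (phi := fun s => e0 + (s - u) * / (v - u) * (e1 - e0)).
    assert (hphi : cnt phi) by (unfold phi; cn).
    assert (phiu : phi u = e0) by (unfold phi; ring).
    assert (phiv : phi v = e1) by (unfold phi; field; lra).
    exists phi, (fun p => P k ((1 - clamp 0 1 (snd p)) * th (fst p) + clamp 0 1 (snd p) * phi (fst p))), 1.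
    split; [lra|]. split; [auto|]. split; [cn|].
    rewrite phiu, phiv.
    split; [apply near_end_zint|]. split; [apply near_end_zint|].
    intros s _. split; [cbn; lia|]. intros t. cbn [fst snd].
    split; [|split; [|split; [|split]]].
    + intros ht. rewrite clamp_lo by lra. rewrite Rminus_0_r, Rmult_1_l, Rmult_0_l, Rplus_0_r.
      unfold th. rewrite <- (hj s). apply P_coords.
    + intros ht. rewrite clamp_hi by lra. unfold del. cbn [filter]. rewrite hj, Nat.eqb_refl. cbn [negb].
      rewrite app_nil_r. f_equal. ring.
    + unfold rho. cbn [flat_map]. unfold retract. rewrite hj, Nat.eqb_refl, app_nil_r.
      rewrite phiu. reflexivity.
    + unfold rho. cbn [flat_map]. unfold retract. rewrite hj, Nat.eqb_refl, app_nil_r.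
      rewrite phiv. reflexivity.
    + apply tail_word_mono with k 1%nat; auto. apply tail_word_P.
  - exists (fun _ => 0), (fun p => [y (fst p)]), 1.
    assert (e : Nat.eqb j k = false) by (apply Nat.eqb_neq; auto).
    split; [lra|]. split; [cn|]. split; [exact (cnt_single _ (cnt_comp _ y hy cnt_fst))|].
    split; [apply zint_0|]. split; [apply zint_0|].
    intros s _. split; [cbn; lia|]. intros t. cbn [fst snd].
    unfold del, rho, retract. cbn [filter flat_map]. rewrite !hj, e. cbn [negb app].
    rewrite (P_zint k 0) by apply zint_0. auto.
Qed.

Lemma first_large_unique e a y b a' y' b' :
  Forall (small e) a -> Forall (small e) a' -> ~ small e y -> ~ small e y' ->
  a ++ y :: b = a' ++ y' :: b' -> a = a' /\ y = y' /\ b = b'.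
Proof.
  intros ha. revert a'. induction ha as [|x a hx ha IH]; intros a' ha' hy hy' E.
  - destruct ha' as [|x a' hx ha']; injection E; intros; subst; auto. contradiction.
  - destruct ha' as [|x' a' hx' ha']; injection E; intros; subst; [contradiction|].
    destruct (IH a') as [-> [-> ->]]; auto.
Qed.

Lemma forall_small_strict e w : 0 < e -> Forall (small e) w ->
  exists d, 0 < d < e /\ Forall (small d) w.
Proof.
  intros he h. apply near_nil_iff in h. destruct (near_strict e [] w he h) as [d [hd h']].
  exists d; split; auto. apply near_nil_iff; auto.
Qed.

(** The first letter that is not small is determined by the word, so a pointwise choice of the
    factorization is already continuous. *)
Lemma path_factor e x w (a : R -> word) : 0 < e -> ~ small (2 * e) x -> cnt a ->
  (forall s, near e (x :: w) (a s)) ->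
  exists (al : R -> word) (y : R -> Hstar) (be : R -> word), cnt al /\ cnt y /\ cnt be /\
    forall s, a s = al s ++ y s :: be s /\ Forall (small e) (al s) /\ nr e x (y s) /\ near e w (be s).
Proof.
  intros he hx ha hn.
  assert (hx' : ~ small e x) by (intro h; apply hx; eapply small_mono; [|exact h]; lra).
  assert (big : forall y, nr e x y -> ~ small e y).
  { intros y hy hs. apply hx. replace (2 * e) with (e + e) by ring.
    apply small_trans with y; auto. apply nr_letter_sym; auto. }
  assert (ex : forall s, exists p : word * Hstar * word,
     a s = fst (fst p) ++ snd (fst p) :: snd p /\ Forall (small e) (fst (fst p)) /\
     nr e x (snd (fst p)) /\ near e w (snd p)).
  { intros s. destruct (near_cons_inv e x w (a s) hx' (hn s)) as [al [y [be h]]].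
    exists (al, y, be). exact h. }
  set (p := fun s => proj1_sig (constructive_indefinite_description _ (ex s))).
  assert (hp : forall s, a s = fst (fst (p s)) ++ snd (fst (p s)) :: snd (p s) /\
     Forall (small e) (fst (fst (p s))) /\ nr e x (snd (fst (p s))) /\ near e w (snd (p s))).
  { intros s. exact (proj2_sig (constructive_indefinite_description _ (ex s))). }
  clearbody p.
  assert (key : forall s e', 0 < e' -> exists d, 0 < d /\ forall s', nr d s s' ->
     near e' (fst (fst (p s))) (fst (fst (p s'))) /\ nr e' (snd (fst (p s))) (snd (fst (p s'))) /\
     near e' (snd (p s)) (snd (p s'))).
  { intros s e' he'. destruct (hp s) as [E [h1 [h2 h3]]].
    set (al := fst (fst (p s))) in *. set (y := snd (fst (p s))) in *. set (be := snd (p s)) in *.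
    destruct (forall_small_strict e al he h1) as [d1 [hd1 hal]].
    destruct (nr_letter_strict e x y h2) as [d2 [hd2 hy]].
    (* Besides e', the radius respects the room left in the strict inequalities at s, so the
       factorization carried over to s' satisfies the same bounds and must be the chosen one. *)
    set (r := Rmin e' (Rmin (e - d1) (e - d2))).
    assert (hr : 0 < r) by (unfold r; repeat apply Rmin_pos; lra).
    assert (hr1 : r <= e') by apply Rmin_l.
    assert (hr2 : r <= e - d1) by (eapply Rle_trans; [apply Rmin_r|apply Rmin_l]).
    assert (hr3 : r <= e - d2) by (eapply Rle_trans; [apply Rmin_r|apply Rmin_r]).
    destruct (ha s r hr) as [d [hd h]]. exists d; split; auto. intros s' hs'.
    specialize (h s' hs'). cbn in h. rewrite E in h.
    destruct (near_split _ _ _ _ h) as [al' [l2 [E' [n1 n2]]]].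
    assert (yr : ~ small r y).
    { intro hc. apply (big y h2). eapply small_mono; [|exact hc]; lra. }
    destruct (near_cons_inv r y be l2 yr n2) as [ga [y' [be' [-> [g1 [g2 g3]]]]]].
    assert (hy' : nr e x y').
    { apply nr_mono with (d2 + r); [lra|]. apply nr_letter_trans with y; auto. }
    destruct (hp s') as [E2 [h1' [h2' h3']]].
    rewrite E', app_assoc in E2.
    assert (hal' : Forall (small e) (al' ++ ga)).
    { apply Forall_app. split.
      - apply Forall_impl with (small (d1 + r)); [intros z; apply small_mono; lra|].
        apply near_small with al; auto; lra.
      - eapply Forall_impl; [|exact g1]. intros z; apply small_mono; lra. }
    destruct (first_large_unique e _ _ _ _ _ _ hal' h1' (big _ hy') (big _ h2') E2) as [<- [<- <-]].
    split; [|split].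
    - apply near_mono with r; auto. rewrite <- (app_nil_r al). apply near_app; auto.
      apply near_nil_iff; auto.
    - apply nr_mono with r; auto.
    - apply near_mono with r; auto. }
  exists (fun s => fst (fst (p s))), (fun s => snd (fst (p s))), (fun s => snd (p s)).
  split; [|split; [|split]]; auto;
    intros s e' he'; destruct (key s e' he') as [d [hd h]]; exists d; split; auto; intros s' hs'; apply h; auto.
Qed.

(** Induction on the large letters: a part with small letters only, one followed letter, and the
    remainder. These cost n + 1 and 2 for each letter, and n + 1 for the last part. *)
Lemma splits_tracked k n u v e w : u < v -> 0 < e ->
  (forall x, small e x -> idx x = k -> ang x <> 1 / 2) ->
  (forall x, In x w -> ~ small (2 * e) x /\ forall y, nr e x y -> idx y = idx x) ->
  forall a, cnt a -> (forall s, near e w (a s)) -> (forall s, tail_word k n (a s)) ->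
  splits k (length w * (n + 3) + (n + 1)) u v a.
Proof.
  intros uv he hmid. induction w as [|x w IH]; intros hw a ha hn ht.
  - apply splits_mono with (S n); [cbn; lia|].
    apply splits_small; auto. intros s x hx. specialize (hn s). apply near_nil_iff in hn.
    rewrite Forall_forall in hn. auto.
  - destruct (hw x (or_introl eq_refl)) as [hx hidx].
    destruct (path_factor e x w a he hx ha hn) as [al [y [be [hal [hy [hbe h]]]]]].
    assert (tal : forall s, tail_word k n (al s)).
    { intros s. destruct (h s) as [E _]. destruct (ht s) as [l1 l2]. rewrite E in l1, l2.
      rewrite length_app in l1. split; [lia|]. intros z hz. apply l2, in_or_app; auto. }
    assert (tbe : forall s, tail_word k n (be s)).
    { intros s. destruct (h s) as [E _]. destruct (ht s) as [l1 l2]. rewrite E in l1, l2.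
      rewrite length_app in l1. cbn in l1. split; [lia|]. intros z hz. apply l2, in_or_app; cbn; auto. }
    assert (kx : (k <= idx x)%nat).
    { destruct (h 0) as [E [_ [h2 _]]]. destruct (ht 0) as [_ l2]. rewrite <- (hidx _ h2).
      apply l2. rewrite E. apply in_or_app; cbn; auto. }
    apply splits_ext with (fun s => al s ++ ([y s] ++ be s)); [lra| |].
    { intros s _. symmetry. apply (proj1 (h s)). }
    apply splits_mono with (S n + (2 + (length w * (n + 3) + (n + 1))))%nat; [cbn; lia|].
    apply splits_app; auto.
    + apply (cnt_app (fun s => [y s]) be); auto. apply cnt_single; auto.
    + apply splits_small; auto. intros s z hz. destruct (h s) as [_ [h1 _]].
      rewrite Forall_forall in h1. auto.
    + apply splits_app; auto.
      * apply cnt_single; auto.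
      * apply splits_letter with (idx x); auto. intros s. apply hidx, (h s).
      * apply IH; auto. intros z hz; apply hw; right; auto. intros s; apply h.
Qed.

(** Near each time the path stays close to one word, whose letters can be followed. Joining
    intervals does not increase the bound, so it depends on [n] alone. *)
Lemma path_splits k n a : cnt a -> (forall s, tail_word k n (a s)) ->
  splits k (n * (n + 3) + (n + 1)) 0 1 a.
Proof.
  intros ha ht. apply interval_induction.
  - intros u v w uv vw. apply splits_join; auto.
  - intros s0 _. destruct (ang_of_small k (1 / 2) ltac:(lra)) as [e0 [he0 h0]].
    destruct (forall_letters_radius (a s0) (fun d x => ~ small (2 * d) x /\ forall y, nr d x y -> idx y = idx x))
      as [e1 [he1 h1]].
    + intros d e x hde [h h']. split.
      * intro hc; apply h. eapply small_mono; [|exact hc]; lra.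
      * intros y hy; apply h'. eapply nr_mono; [|exact hy]; lra.
    + intros x _. destruct (not_small x) as [r [hr h]].
      destruct (coords_locally x 1 ltac:(lra)) as [r' [hr' h']].
      exists (Rmin (r / 2) r'). pose proof (Rmin_l (r / 2) r'). pose proof (Rmin_r (r / 2) r').
      split; [apply Rmin_pos; lra|]. split.
      * intro hc; apply h. eapply small_mono; [|exact hc]; lra.
      * intros y hy. apply h'. eapply nr_mono; [|exact hy]; auto.
    + set (e := Rmin e0 e1). assert (he : 0 < e) by (apply Rmin_pos; auto).
      assert (e <= e0) by apply Rmin_l. assert (e <= e1) by apply Rmin_r.
      destruct (ha s0 e he) as [d [hd h]]. exists d; split; auto.
      intros u v uv _ _ hu hv.
      apply splits_ext with (fun s => a (clamp u v s)); [lra| |].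
      { intros s hs. rewrite clamp_id; auto. }
      apply splits_mono with (length (a s0) * (n + 3) + (n + 1))%nat.
      { destruct (ht s0) as [l _]. nia. }
      apply splits_tracked with e; auto.
      * intros x hx hk. destruct (h0 x) as [l|l]; auto; [eapply small_mono; [|exact hx]; auto| |]; lra.
      * intros x hx. destruct (h1 x hx) as [g g']. split.
        -- intro hc; apply g. eapply small_mono; [|exact hc]; lra.
        -- intros y hy; apply g'. eapply nr_mono; [|exact hy]; auto.
      * cn.
      * intros s. apply h. cbn. pose proof (clamp_in u v s ltac:(lra)). apply Rabs_def1; lra.
Qed.

(** * Peeling a circle off a loop *)

Definition outside (s : R) : Prop := s <= 0 \/ 1 <= s.

Definition word_loop (k n : nat) (a : R -> word) : Prop :=
  cnt a /\ (forall s, outside s -> a s = []) /\ (forall s, tail_word k n (a s)).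

Definition turns (k : nat) (m : R) (s : R) : word := P k (m * clamp 0 1 s).

Lemma turns_lo k m s : s <= 0 -> turns k m s = [].
Proof. intros h. unfold turns. rewrite clamp_lo, Rmult_0_r by lra. apply P_zint, zint_0. Qed.

Lemma turns_hi k m s : zint m -> 1 <= s -> turns k m s = [].
Proof. intros hm h. unfold turns. rewrite clamp_hi, Rmult_1_r by lra. apply P_zint, hm. Qed.

Definition then_loop (k : nat) (m : R) (b : R -> word) (s : R) : word :=
  if Rle_dec (s - / 2) 0 then turns k m (2 * s) else b (2 * s - 1).

Definition word_homotopy (k n : nat) (a b : R -> word) (H : R * R -> word) : Prop :=
  cnt H /\ forall s t, (t <= 0 -> H (s, t) = a s) /\ (1 <= t -> H (s, t) = b s) /\
    (outside s -> H (s, t) = []) /\ tail_word k n (H (s, t)).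

Definition split_bound (n : nat) : nat := n * (n + 3) + (n + 1).

(** The splitting gives a product of a path in the circle k and the rest, run simultaneously. Its
    angle runs between integers, so the product slides to a concatenation, with [m] the net change
    of angle. *)
Lemma peel_circle k n a : word_loop k n a ->
  exists m H, zint m /\ word_homotopy k (split_bound n) a (then_loop k m (fun s => del k (a s))) H.
Proof.
  intros [ha [hout ht]].
  destruct (path_splits k n a ha ht) as [phi [F [T [hT [hphi [hF [z0 [z1 h]]]]]]]].
  fold (split_bound n) in h.
  set (m := phi 1 - phi 0). exists m.
  (* At the final stage all turning happens linearly during the first half, and the rest is run
     during the second half. The integer [phi 0] has no effect on the word. *)
  set (F2 := fun p : R * R => P k ((1 - snd p) * phi (clamp 0 1 ((1 - snd p) * fst p + 2 * snd p * fst p))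
                 + snd p * (phi 0 + m * clamp 0 1 (2 * fst p)))
               ++ del k (a ((1 - snd p) * fst p + snd p * (2 * fst p - 1)))).
  assert (hF2 : cnt F2) by (unfold F2; cn).
  exists (fun p => if Rle_dec (snd p - / 2) 0 then F (clamp 0 1 (fst p), 2 * T * snd p)
                   else F2 (fst p, clamp 0 1 (2 * snd p - 1))).
  split; [apply zint_sub; auto|].
  assert (acl : forall s, a (clamp 0 1 s) = a s).
  { intros s. destruct (Rle_or_lt s 0); [|destruct (Rle_or_lt 1 s)].
    - rewrite clamp_lo by lra. rewrite !hout by (unfold outside; lra). auto.
    - rewrite clamp_hi by lra. rewrite !hout by (unfold outside; lra). auto.
    - rewrite clamp_id by lra. auto. }
  split.
  { apply cnt_paste; [cn|cn|cn|]. intros [s t] e. cbn [fst snd] in *.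
    replace t with (/ 2) by lra. rewrite (clamp_lo 0 1 (2 * / 2 - 1)) by lra.
    destruct (h (clamp 0 1 s) (clamp_in 0 1 s ltac:(lra))) as [_ g].
    destruct (g (2 * T * / 2)) as [_ [-> _]]; [|lra].
    unfold F2; cbn [fst snd]. rewrite acl. f_equal; f_equal.
    - replace ((1 - 0) * s + 2 * 0 * s) with s by ring. ring.
    - f_equal. ring. }
  intros s t. cbn [fst snd].
  destruct (h (clamp 0 1 s) (clamp_in 0 1 s ltac:(lra))) as [_ g].
  pose proof (clamp_in 0 1 (2 * t - 1) ltac:(lra)) as hc.
  split; [|split; [|split]].
  - intros ht0. destruct (Rle_dec _ _); [|lra]. rewrite <- (acl s). apply g. nra.
  - intros ht1. destruct (Rle_dec _ _); [lra|]. rewrite clamp_hi by lra.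
    unfold F2, then_loop, turns; cbn [fst snd].
    rewrite Rminus_diag, !Rmult_0_l, !Rmult_1_l, !Rplus_0_l, Rplus_comm, P_add_zint by auto.
    destruct (Rle_dec _ _).
    + rewrite (hout (2 * s - 1)) by (unfold outside; lra). cbn. apply app_nil_r.
    + rewrite clamp_hi, Rmult_1_r, (P_zint k m); [auto|apply zint_sub; auto|lra|lra].
  - intros ho. destruct (Rle_dec _ _).
    + assert (F (clamp 0 1 s, 2 * T * t) = rho k (2 * T * t) []) as ->; [|reflexivity].
      destruct ho.
      * rewrite clamp_lo by lra. destruct (h 0 ltac:(lra)) as [_ g'].
        destruct (g' (2 * T * t)) as [_ [_ [-> _]]]. rewrite hout; auto. unfold outside; lra.
      * rewrite clamp_hi by lra. destruct (h 0 ltac:(lra)) as [_ g'].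
        destruct (g' (2 * T * t)) as [_ [_ [_ [-> _]]]]. rewrite hout; auto. unfold outside; lra.
    + unfold F2; cbn [fst snd]. set (c := clamp 0 1 (2 * t - 1)) in *.
      rewrite hout by (unfold outside in *; destruct ho; [left|right]; nra). cbn. rewrite app_nil_r.
      apply P_zint. destruct ho.
      * rewrite !clamp_lo by nra. match goal with |- zint ?x => replace x with (phi 0) by ring end. auto.
      * rewrite !clamp_hi by nra. match goal with |- zint ?x => replace x with (phi 1) by (unfold m; ring) end. auto.
  - destruct (Rle_dec _ _); [apply g|]. unfold F2.
    apply tail_word_mono with k (1 + n)%nat; auto; [unfold split_bound; lia|].
    apply tail_word_app; [apply tail_word_P|].
    apply tail_word_mono with (S k) n; auto. apply tail_word_del; auto.
Qed.

(** * Infinite concatenation *)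

(** Where later terms differ from the j-th, both words use only circles from j on, hence are
    uniformly small for large j. The limit is therefore uniform, and continuity passes to it. *)
Lemma limit_of_words {D} `{nearness D} N (F : nat -> D -> word) :
  (forall j, cnt (F j)) ->
  (forall j i p, F (j + i)%nat p = F j p \/ (tail_word j N (F j p) /\ tail_word j N (F (j + i)%nat p))) ->
  (forall p, exists j0, forall i, F (j0 + i)%nat p = F j0 p) ->
  exists G, cnt G /\ forall p, exists j0, forall i, F (j0 + i)%nat p = G p.
Proof.
  intros hF diff ev.
  set (j0 := fun p => proj1_sig (constructive_indefinite_description _ (ev p))).
  assert (hj : forall p i, F (j0 p + i)%nat p = F (j0 p) p).
  { intros p. exact (proj2_sig (constructive_indefinite_description _ (ev p))). }
  clearbody j0.
  exists (fun p => F (j0 p) p). split.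
  - intros p e he. destruct (tail_word_small (e / 3 / 2) ltac:(lra)) as [K hK].
    assert (close : forall q, near (e / 3) (F K q) (F (j0 q) q)).
    { intros q. destruct (diff K (j0 q) q) as [E|[h1 h2]]; rewrite <- (hj q K), (Nat.add_comm (j0 q) K).
      - rewrite E. apply near_refl; lra.
      - apply small_near; [lra|eapply hK, h1|eapply hK, h2]. }
    destruct (hF K p (e / 3) ltac:(lra)) as [d [hd h]]. exists d; split; auto.
    intros q hq. cbn. replace e with (e / 3 + (e / 3 + e / 3)) by field.
    apply near_trans with (F K p); [lra|lra|apply near_sym, close|].
    apply near_trans with (F K q); [lra|lra|apply h; auto|apply close].
  - intros p. exists (j0 p). intros i. apply hj.
Qed.

Lemma pow2_large r : 0 < r -> exists j, 1 / 2 <= 2 ^ j * r.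
Proof.
  intros hr. destruct (Pow_x_infinity 2 ltac:(rewrite Rabs_pos_eq; lra) (/ r)) as [j hj].
  exists j. specialize (hj j (le_n j)). rewrite Rabs_pos_eq in hj by (apply pow_le; lra).
  apply Rge_le in hj. apply Rmult_le_compat_r with (r := r) in hj; [|lra].
  rewrite Rinv_l in hj by lra. lra.
Qed.

(* The first [j] stages of the loop turning [m k] times around the circle [k]
   during [1 - 2^-k, 1 - 2^-(k+1)]. *)
Fixpoint spiral_stage (m : nat -> R) (j k : nat) (s : R) : word :=
  match j with
  | O => []
  | S j => then_loop k (m k) (spiral_stage m j (S k)) s
  end.

Definition spiral (m : nat -> R) (L : R -> word) : Prop :=
  forall s, exists j0, forall i, spiral_stage m (j0 + i) 0 s = L s.

Section Stages.
Variable m : nat -> R.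
Hypothesis hm : forall k, zint (m k).

Lemma spiral_stage_outside j k s : outside s -> spiral_stage m j k s = [].
Proof.
  revert k s. induction j as [|j IH]; intros k s hs; [reflexivity|].
  cbn [spiral_stage]. unfold then_loop. destruct (Rle_dec _ _).
  - apply turns_lo. unfold outside in hs. lra.
  - apply IH. unfold outside in *. lra.
Qed.

Lemma cnt_then_loop k b : cnt b -> b 0 = [] -> cnt (then_loop k (m k) b).
Proof.
  intros hb b0. unfold then_loop. apply cnt_paste; [cn|unfold turns; cn|cn|].
  intros s e. replace (2 * s - 1) with 0 by lra. rewrite b0. apply turns_hi; auto; lra.
Qed.

Lemma cnt_spiral_stage j k : cnt (spiral_stage m j k).
Proof.
  revert k. induction j as [|j IH]; intros k; cbn [spiral_stage]; [apply cnt_const|].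
  apply cnt_then_loop; auto. apply spiral_stage_outside. unfold outside; lra.
Qed.

Lemma tail_word_spiral_stage j k s : tail_word k 1 (spiral_stage m j k s).
Proof.
  revert k s. induction j as [|j IH]; intros k s; cbn [spiral_stage]; [apply tail_word_nil|].
  unfold then_loop. destruct (Rle_dec _ _); [apply tail_word_P|].
  apply tail_word_mono with (S k) 1%nat; auto.
Qed.

Lemma spiral_stage_diff j i k s : spiral_stage m (j + i) k s = spiral_stage m j k s \/
  (tail_word (k + j) 1 (spiral_stage m j k s) /\ tail_word (k + j) 1 (spiral_stage m (j + i) k s)).
Proof.
  revert k s. induction j as [|j IH]; intros k s.
  - right. rewrite Nat.add_0_r. split; apply tail_word_spiral_stage.
  - cbn [spiral_stage Nat.add]. unfold then_loop. destruct (Rle_dec _ _); auto.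
    rewrite Nat.add_succ_r, <- Nat.add_succ_l. apply IH.
Qed.

(** The condition reads s <= 1 - 2^-(j+1): the time lies within the first j + 1 pieces, where the
    truncation is not seen. *)
Lemma spiral_stage_stable j i k s : 1 / 2 <= 2 ^ j * (1 - s) ->
  spiral_stage m (S j + i) k s = spiral_stage m (S j) k s.
Proof.
  revert k s. induction j as [|j IH]; intros k s hs; cbn [spiral_stage Nat.add]; unfold then_loop.
  - destruct (Rle_dec _ _); auto. cbn in hs. lra.
  - destruct (Rle_dec _ _); auto. apply (IH (S k) (2 * s - 1)). cbn in hs. nra.
Qed.

Lemma spiral_stage_eventually s : exists j0, forall i,
  spiral_stage m (j0 + i) 0 s = spiral_stage m j0 0 s.
Proof.
  destruct (Rle_or_lt 1 s) as [l|l].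
  - exists 0%nat. intros i. rewrite !spiral_stage_outside; auto; unfold outside; lra.
  - destruct (pow2_large (1 - s) ltac:(lra)) as [j hj]. exists (S j). intros i.
    apply spiral_stage_stable; auto.
Qed.

Lemma spiral_exists : exists L, spiral m L /\ word_loop 0 1 L.
Proof.
  destruct (limit_of_words 1 (fun j => spiral_stage m j 0)) as [L [hL h]].
  - intros j. apply cnt_spiral_stage.
  - intros j i s. apply (spiral_stage_diff j i 0 s).
  - apply spiral_stage_eventually.
  - exists L. split; [exact h|]. split; [exact hL|]. split.
    + intros s hs. destruct (h s) as [j0 E]. rewrite <- (E 0%nat). apply spiral_stage_outside; auto.
    + intros s. destruct (h s) as [j0 E]. rewrite <- (E 0%nat). apply tail_word_spiral_stage.
Qed.

Variable N : nat.
Variable A : nat -> R -> word.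
Variable H : nat -> R * R -> word.
Hypothesis hA : forall k, cnt (A k).
Hypothesis hH : forall k, word_homotopy k N (A k) (then_loop k (m k) (A (S k))) (H k).

(** The lower half of the square runs [H k]. Above it, the turns of the circle k are kept fixed on
    the left, and the construction is repeated for k + 1 in the upper right quarter; the successive
    squares shrink to the corner (1, 1). *)
Fixpoint stack (j k : nat) (p : R * R) : word :=
  match j with
  | O => A k (fst p)
  | S j => if Rle_dec (snd p - / 2) 0 then H k (fst p, 2 * snd p)
           else then_loop k (m k) (fun s => stack j (S k) (s, 2 * snd p - 1)) (fst p)
  end.

Lemma A_eq k s : H k (s, 0) = A k s.
Proof. apply (hH k). lra. Qed.

Lemma stack_bottom j k s t : t <= 0 -> stack j k (s, t) = A k s.
Proof.
  intros ht. destruct j; [reflexivity|]. cbn [stack fst snd].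
  destruct (Rle_dec _ _); [|lra]. apply (hH k). lra.
Qed.

Lemma stack_outside j k s t : outside s -> stack j k (s, t) = [].
Proof.
  revert k s t. induction j as [|j IH]; intros k s t hs; cbn [stack fst snd].
  - rewrite <- A_eq. apply (hH k); auto.
  - destruct (Rle_dec _ _); [apply (hH k); auto|]. unfold then_loop. destruct (Rle_dec _ _).
    + apply turns_lo. unfold outside in hs. lra.
    + apply IH. unfold outside in *. lra.
Qed.

Lemma cnt_stack j k : cnt (stack j k).
Proof.
  revert k. induction j as [|j IH]; intros k; cbn [stack].
  - apply (cnt_comp fst (A k)); auto. apply cnt_fst.
  - pose proof (proj1 (hH k)) as c1. specialize (IH (S k)). apply cnt_paste.
    + cn.
    + apply (cnt_comp (fun p : R * R => (fst p, 2 * snd p)) (H k)); [auto|cn].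
    + unfold then_loop. apply cnt_paste; [cn|unfold turns; cn| |].
      * apply (cnt_comp (fun p : R * R => (2 * fst p - 1, 2 * snd p - 1)) (stack j (S k))); [auto|cn].
      * intros [s t] e; cbn [fst snd] in *. replace (2 * s - 1) with 0 by lra.
        rewrite stack_outside by (unfold outside; lra). apply turns_hi; auto; lra.
    + intros [s t] e; cbn [fst snd] in *. replace (2 * t) with 1 by lra.
      destruct (proj2 (hH k) s 1) as [_ [-> _]]; [|lra].
      unfold then_loop. destruct (Rle_dec _ _); auto. rewrite stack_bottom; auto; lra.
Qed.

Lemma tail_word_stack j k p : (1 <= N)%nat -> tail_word k N (stack j k p).
Proof.
  intros hN. revert k p. induction j as [|j IH]; intros k [s t]; cbn [stack fst snd].
  - rewrite <- A_eq. apply (hH k).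
  - destruct (Rle_dec _ _); [apply (hH k)|]. unfold then_loop. destruct (Rle_dec _ _).
    + apply tail_word_mono with k 1%nat; auto. apply tail_word_P.
    + apply tail_word_mono with (S k) N; auto.
Qed.

Lemma stack_diff j i k p : (1 <= N)%nat -> stack (j + i) k p = stack j k p \/
  (tail_word (k + j) N (stack j k p) /\ tail_word (k + j) N (stack (j + i) k p)).
Proof.
  intros hN. revert k p. induction j as [|j IH]; intros k p.
  - right. rewrite Nat.add_0_r. split; apply tail_word_stack; auto.
  - cbn [stack Nat.add]. unfold then_loop. destruct (Rle_dec _ _); auto. destruct (Rle_dec _ _); auto.
    rewrite Nat.add_succ_r, <- Nat.add_succ_l. apply IH.
Qed.

Lemma stack_stable j i k s t : 1 / 2 <= 2 ^ j * (1 - s) ->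
  stack (S j + i) k (s, t) = stack (S j) k (s, t).
Proof.
  revert k s t. induction j as [|j IH]; intros k s t hs; cbn [Nat.add].
  - cbn [stack fst snd]. unfold then_loop.
    destruct (Rle_dec _ _); auto. destruct (Rle_dec _ _); auto. cbn in hs. lra.
  - cbn [stack fst snd]. unfold then_loop.
    destruct (Rle_dec (t - _) _); auto. destruct (Rle_dec (s - _) _); auto.
    apply (IH (S k) (2 * s - 1)). cbn in hs. nra.
Qed.

(** In the innermost square [stack] still has a path [A] where [spiral_stage] is empty, so the time
    must lie to the left of it. *)
Lemma stack_top j i k s t : 1 / 2 <= 2 ^ j * (1 - s) -> 1 <= t ->
  stack (S j + i) k (s, t) = spiral_stage m (S j + i) k s.
Proof.
  revert k s t. induction j as [|j IH]; intros k s t hs ht; cbn [Nat.add].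
  - cbn [stack spiral_stage fst snd]. unfold then_loop.
    destruct (Rle_dec _ _); [lra|]. destruct (Rle_dec _ _); auto. cbn in hs. lra.
  - cbn [stack spiral_stage fst snd]. unfold then_loop.
    destruct (Rle_dec (t - _) _); [lra|]. destruct (Rle_dec (s - _) _); auto.
    apply (IH (S k) (2 * s - 1)); [|lra]. cbn in hs. nra.
Qed.

Lemma stack_homotopy L : (1 <= N)%nat -> spiral m L -> exists G, word_homotopy 0 N (A 0%nat) L G.
Proof.
  intros hN hL.
  destruct (limit_of_words N (fun j => stack j 0)) as [G [hG h]].
  - intros j. apply cnt_stack.
  - intros j i p. apply (stack_diff j i 0 p hN).
  - intros [s t]. destruct (Rle_or_lt 1 s) as [l|l].
    + exists 0%nat. intros i. rewrite !stack_outside; auto; unfold outside; lra.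
    + destruct (pow2_large (1 - s) ltac:(lra)) as [j hj]. exists (S j). intros i.
      apply stack_stable; auto.
  - exists G. split; auto. intros s t. destruct (h (s, t)) as [j0 E]. split; [|split; [|split]].
    + intros ht. rewrite <- (E 0%nat). apply stack_bottom; auto.
    + intros ht. destruct (hL s) as [j1 E1]. destruct (Rle_or_lt 1 s) as [l|l].
      * rewrite <- (E 0%nat), <- (E1 0%nat).
        rewrite stack_outside, spiral_stage_outside; auto; unfold outside; lra.
      * destruct (pow2_large (1 - s) ltac:(lra)) as [j hj].
        rewrite <- (E (S j + j1)%nat), <- (E1 (S j + j0)%nat).
        replace (j0 + (S j + j1))%nat with (S j + (j0 + j1))%nat by lia.
        replace (j1 + (S j + j0))%nat with (S j + (j0 + j1))%nat by lia.
        apply stack_top; auto.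
    + intros hs. rewrite <- (E 0%nat). apply stack_outside; auto.
    + rewrite <- (E 0%nat). apply tail_word_stack; auto.
Qed.

End Stages.

(** * Normal form of a loop *)

Fixpoint delete_below (k : nat) (w : word) : word :=
  match k with O => w | S k => del k (delete_below k w) end.

Lemma word_loop_delete_below n a k : word_loop 0 n a -> word_loop k n (fun s => delete_below k (a s)).
Proof.
  intros h. induction k as [|k IH]; auto. cbn [delete_below]. destruct IH as [h1 [h2 h3]].
  split; [cn|]. split.
  - intros s hs. rewrite h2; auto.
  - intros s. apply tail_word_del; auto.
Qed.

(** Deletion does not lengthen words, so one bound serves all k. The single peelings are kept in the
    conclusion because they identify [m k] as a winding number. *)
Lemma word_loop_normal_form n a : word_loop 0 n a ->
  exists m, (forall k, zint (m k)) /\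
    (forall k, exists H, word_homotopy k (split_bound n) (fun s => delete_below k (a s))
        (then_loop k (m k) (fun s => delete_below (S k) (a s))) H) /\
    forall L, spiral m L -> exists G, word_homotopy 0 (split_bound n) a L G.
Proof.
  intros ha.
  assert (hA : forall k, word_loop k n (fun s => delete_below k (a s))).
  { intros k. apply word_loop_delete_below; auto. }
  assert (ex : forall k, exists q : R * (R * R -> word), zint (fst q) /\
     word_homotopy k (split_bound n) (fun s => delete_below k (a s))
        (then_loop k (fst q) (fun s => delete_below (S k) (a s))) (snd q)).
  { intros k. destruct (peel_circle k n _ (hA k)) as [m [H h]]. exists (m, H). exact h. }
  set (q := fun k => proj1_sig (constructive_indefinite_description _ (ex k))).
  assert (hq : forall k, zint (fst (q k)) /\
     word_homotopy k (split_bound n) (fun s => delete_below k (a s))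
        (then_loop k (fst (q k)) (fun s => delete_below (S k) (a s))) (snd (q k))).
  { intros k. exact (proj2_sig (constructive_indefinite_description _ (ex k))). }
  clearbody q.
  exists (fun k => fst (q k)). split; [intros k; apply hq|]. split.
  - intros k. exists (snd (q k)). apply hq.
  - intros L hL. apply (stack_homotopy (fun k => fst (q k)) (fun k => proj1 (hq k)) (split_bound n)
      (fun k s => delete_below k (a s)) (fun k => snd (q k))); auto.
    + intros k. apply hA.
    + intros k. apply hq.
    + unfold split_bound; lia.
Qed.

(** * The given topologies in terms of nearness *)

Lemma abs_lt_of_sum_sq a b r : 0 < r -> a ^ 2 + b ^ 2 < r ^ 2 -> Rabs a < r /\ Rabs b < r.
Proof.
  intros hr h. split; apply Rsqr_incrst_0; try apply Rabs_pos; try lra; rewrite <- Rsqr_abs;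
    unfold Rsqr; nra.
Qed.

Lemma R2_box_open (p : R * R) e : isopen R2sp (fun q : R * R => nr e p q).
Proof.
  intros q [h1 h2]. cbn in h1, h2.
  set (r := Rmin (e - Rabs (fst q - fst p)) (e - Rabs (snd q - snd p))).
  assert (hr : 0 < r) by (apply Rmin_pos; lra).
  exists r. split; auto. intros q' h.
  assert (r <= e - Rabs (fst q - fst p)) by apply Rmin_l.
  assert (r <= e - Rabs (snd q - snd p)) by apply Rmin_r.
  destruct (abs_lt_of_sum_sq _ _ _ hr h) as [g1 g2].
  split; cbn.
  - replace (fst q' - fst p) with ((fst q' - fst q) + (fst q - fst p)) by ring.
    eapply Rle_lt_trans; [apply Rabs_triang|lra].
  - replace (snd q' - snd p) with ((snd q' - snd q) + (snd q - snd p)) by ring.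
    eapply Rle_lt_trans; [apply Rabs_triang|lra].
Qed.

Lemma R2_open_box (V : R * R -> Prop) p : isopen R2sp V -> V p ->
  exists e, 0 < e /\ forall q : R * R, nr e p q -> V q.
Proof.
  intros hV hp. destruct (hV p hp) as [e [he h]]. exists (e / 2). split; [lra|].
  intros q [h1 h2]. apply h. cbn in h1, h2. apply Rabs_def2 in h1, h2. nra.
Qed.

Lemma H_ball_open (x : Hsp) e : isopen Hsp (fun y : Hsp => nr e x y).
Proof.
  exists (fun q : R * R => nr e (proj1_sig x : R * R) q). split; [apply R2_box_open|].
  intros y. reflexivity.
Qed.

Lemma H_open_ball (U : Hsp -> Prop) (x : Hsp) : isopen Hsp U -> U x ->
  exists e, 0 < e /\ forall y : Hsp, nr e x y -> U y.
Proof.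
  intros [V [hV E]] hx. apply E in hx. destruct (R2_open_box V _ hV hx) as [e [he h]].
  exists e; split; auto. intros y hy. apply E, h, hy.
Qed.

Lemma S1_ball_open (x : S1sp) e : isopen S1sp (fun y : S1sp => nr e x y).
Proof.
  exists (fun q : R * R => nr e (proj1_sig x : R * R) q). split; [apply R2_box_open|].
  intros y. reflexivity.
Qed.

Lemma S1_open_ball (U : S1sp -> Prop) (x : S1sp) : isopen S1sp U -> U x ->
  exists e, 0 < e /\ forall y : S1sp, nr e x y -> U y.
Proof.
  intros [V [hV E]] hx. apply E in hx. destruct (R2_open_box V _ hV hx) as [e [he h]].
  exists e; split; auto. intros y hy. apply E, h, hy.
Qed.

Lemma near_reduce e (l l' : list Hsp) : 0 < e ->
  Forall2 (fun x y : Hsp => nr e x y) l l' -> near e (reduce l) (reduce l').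
Proof.
  intros he. induction 1; [apply near_nil|].
  rewrite !reduce_cons. apply near_app; auto. apply near_sigmaJ; auto.
Qed.

Lemma sigmaJ_length x : (length (sigmaJ x) <= 1)%nat.
Proof.
  destruct (sigmaJ_cases x) as [->|[y <-]]; rewrite ?sigmaJ_b0, ?sigmaJ_letter; cbn; auto.
Qed.

Lemma reduce_length (l : list Hsp) : (length (reduce l) <= length l)%nat.
Proof.
  induction l as [|x l IH]; [cbn; auto|]. rewrite reduce_cons, length_app.
  pose proof (sigmaJ_length x). change (length (x :: l)) with (S (length l)). lia.
Qed.

Lemma Forall2_map_l {X Y Z} (R0 : Y -> Z -> Prop) (f : X -> Y) l l' :
  Forall2 R0 (map f l) l' <-> Forall2 (fun x z => R0 (f x) z) l l'.
Proof.
  split.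
  - revert l'. induction l as [|x l IH]; intros l' h; inversion h; subst; constructor; auto.
  - induction 1; cbn; constructor; auto.
Qed.

(** The radius may depend on the length bound, as the weak topology examines each J_n on its own. *)
Lemma J_open_intro (U : Jsp -> Prop) :
  (forall (w : word) n, U w -> exists e, 0 < e /\
     forall w' : word, (length w' <= n)%nat -> near e w w' -> U w') -> isopen Jsp U.
Proof.
  intros h n l hl hU. destruct (h (reduce l) n hU) as [e [he h']].
  exists (map (fun x y : Hsp => nr e x y) l). split; [|split].
  - apply Forall_map, Forall_forall. intros x _. apply H_ball_open.
  - apply Forall2_map_l. clear - he. induction l; constructor; auto.
    apply (nr_refl (X := Hsp)); auto.
  - intros l' hl'. apply Forall2_map_l in hl'. apply h'.
    + eapply Nat.le_trans; [apply reduce_length|].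
      rewrite <- (Forall2_length hl'), hl. auto.
    + apply near_reduce; auto.
Qed.

Lemma near_ball_open e (w : word) : 0 < e -> isopen Jsp (fun w' => near e w w').
Proof.
  intros he. apply J_open_intro. intros w' n h.
  destruct (near_strict e w w' he h) as [d [hd h']]. exists (e - d). split; [lra|].
  intros w'' _ h''. replace e with (d + (e - d)) by ring. apply near_trans with w'; auto; lra.
Qed.

Lemma box_radius (Us : list (Hsp -> Prop)) l : Forall (isopen Hsp) Us ->
  Forall2 (fun (U : Hsp -> Prop) x => U x) Us l ->
  exists e, 0 < e /\ forall l', Forall2 (fun x y : Hsp => nr e x y) l l' ->
    Forall2 (fun (U : Hsp -> Prop) x => U x) Us l'.
Proof.
  intros ho h. induction h as [|U x Us l hx h IH].
  - exists 1; split; [lra|]. intros l' hl'; inversion hl'; constructor.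
  - inversion ho as [|? ? ho1 ho2]; subst. destruct (IH ho2) as [e [he g]].
    destruct (H_open_ball U x ho1 hx) as [e' [he' g']].
    exists (Rmin e e'). split; [apply Rmin_pos; auto|].
    intros l' hl'. inversion hl' as [|? y ? l2 hy hl2]; subst. constructor.
    + apply g'. eapply (nr_mono (X := Hsp)); [apply Rmin_r|exact hy].
    + apply g. eapply Forall2_impl; [|exact hl2]. intros a b hab.
      eapply (nr_mono (X := Hsp)); [apply Rmin_l|exact hab].
Qed.

(* This rests on a reduced word having only finitely many representatives of length [n]. *)
Lemma representatives_radius n (w : word) (Q : list Hsp -> R -> Prop) :
  (forall l d e, d <= e -> Q l e -> Q l d) ->
  (forall l, length l = n -> reduce l = w -> exists e, 0 < e /\ Q l e) ->
  exists e, 0 < e /\ forall l, length l = n -> reduce l = w -> Q l e.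
Proof.
  revert w Q. induction n as [|n IH]; intros w Q mono h.
  - destruct w as [|x w].
    + destruct (h [] eq_refl eq_refl) as [e [he h']]. exists e; split; auto.
      intros [|y l] hl _; [exact h'|discriminate].
    + exists 1; split; [lra|]. intros [|y l] hl e; discriminate.
  (* The head of a representative is either [b0] or the first letter of [w]; the induction
     hypothesis is used once for each case. *)
  - destruct (IH w (fun l => Q (b0 :: l))) as [e [he h1]].
    + intros l d e hd hq. apply mono with e; auto.
    + intros l hl hr. apply h; [exact (f_equal S hl)|]. rewrite reduce_cons, sigmaJ_b0. exact hr.
    + assert (h2 : exists e', 0 < e' /\ forall x w1 l, w = x :: w1 -> length l = n -> reduce l = w1 ->
          Q ((proj1_sig x : Hsp) :: l) e').
      { destruct w as [|x w1]; [exists 1; split; [lra|discriminate]|].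
        destruct (IH w1 (fun l => Q ((proj1_sig x : Hsp) :: l))) as [e' [he' h2]].
        - intros l d e'' hd hq. apply mono with e''; auto.
        - intros l hl hr. apply h; [exact (f_equal S hl)|].
          rewrite reduce_cons, sigmaJ_letter, hr. reflexivity.
        - exists e'; split; auto. intros y w2 l E hl hr. injection E as <- <-. auto. }
      destruct h2 as [e' [he' h2]]. exists (Rmin e e'). split; [apply Rmin_pos; auto|].
      intros [|p l] hl hr; [discriminate|]. injection hl as hl.
      rewrite reduce_cons in hr. destruct (sigmaJ_cases p) as [->|[x <-]].
      * rewrite sigmaJ_b0 in hr. apply mono with e; [apply Rmin_l|]. apply h1; auto.
      * rewrite sigmaJ_letter in hr. apply mono with e'; [apply Rmin_r|].
        apply h2 with (reduce l); auto.
Qed.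

(** No letter of [w] can vanish. Each inserted letter of [w'] is paired with [b0], and both lists
    are padded with [b0] up to length n. *)
Lemma near_representatives e (w w' : word) n : 0 < e -> (forall x, In x w -> ~ small e x) ->
  near e w w' -> (length w' <= n)%nat ->
  exists l l' : list Hsp, length l = n /\ reduce l = w /\ reduce l' = w' /\
    Forall2 (fun x y : Hsp => nr e x y) l l'.
Proof.
  intros he hw h. revert n. induction h as [|x l l' hx h IH|x l l' hx h IH|x y l l' hx h IH]; intros n hn.
  - exists (repeat b0 n), (repeat b0 n). split; [apply repeat_length|]. clear hn.
    assert (E : reduce (repeat b0 n) = []).
    { induction n; auto. cbn [repeat]. rewrite reduce_cons, sigmaJ_b0. auto. }
    repeat (split; [exact E|]). clear E. induction n; cbn [repeat]; constructor; auto.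
    apply (nr_refl (X := Hsp)); auto.
  - destruct (hw x (or_introl eq_refl)); auto.
  - destruct n as [|n]; [cbn in hn; lia|]. destruct (IH hw n) as [k [k' [h1 [h2 [h3 h4]]]]]; [cbn in hn; lia|].
    exists (b0 :: k), ((proj1_sig x : Hsp) :: k'). split; [exact (f_equal S h1)|].
    rewrite !reduce_cons, sigmaJ_b0, sigmaJ_letter, h2, h3. repeat (split; [reflexivity|]).
    constructor; auto.
  - destruct n as [|n]; [cbn in hn; lia|].
    destruct (IH (fun z hz => hw z (or_intror hz)) n) as [k [k' [h1 [h2 [h3 h4]]]]]; [cbn in hn; lia|].
    exists ((proj1_sig x : Hsp) :: k), ((proj1_sig y : Hsp) :: k'). split; [exact (f_equal S h1)|].
    rewrite !reduce_cons, !sigmaJ_letter, h2, h3. repeat (split; [reflexivity|]).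
    constructor; auto.
Qed.

(** Each representative of [w] of length n has a box inside the preimage of [U], and one radius
    serves all of them. Below the sizes of the letters of [w], a near word lifts to a point of one
    of these boxes. *)
Lemma J_open_near (U : Jsp -> Prop) (w : word) n : isopen Jsp U -> U w ->
  exists e, 0 < e /\ forall w' : word, (length w' <= n)%nat -> near e w w' -> U w'.
Proof.
  intros hU hw.
  destruct (representatives_radius n w (fun l e =>
     forall l', Forall2 (fun x y : Hsp => nr e x y) l l' -> U (reduce l'))) as [e [he h]].
  - intros l d e hd g l' hl'. apply g. eapply Forall2_impl; [|exact hl'].
    intros a b hab. eapply (nr_mono (X := Hsp)); eassumption.
  - intros l hl hr. destruct (hU n l hl) as [Us [h1 [h2 h3]]]; [rewrite hr; exact hw|].
    destruct (box_radius Us l h1 h2) as [e [he g]]. exists e; split; auto.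
  - destruct (forall_letters_radius w (fun d x => ~ small d x)) as [e' [he' h']].
    + intros d d' x hd hx hc. apply hx. eapply small_mono; [|exact hc]; lra.
    + intros x _. apply not_small.
    + exists (Rmin e e'). assert (hm : 0 < Rmin e e') by (apply Rmin_pos; auto). split; auto.
      intros w' hw' hn. destruct (near_representatives (Rmin e e') w w' n) as [l [l' [h1 [h2 [h3 h4]]]]]; auto.
      * intros x hx hc. apply (h' x hx). eapply small_mono; [apply Rmin_r|exact hc].
      * rewrite <- h3. apply (h l h1 h2). eapply Forall2_impl; [|exact h4].
        intros a b hab. eapply (nr_mono (X := Hsp)); [apply Rmin_l|exact hab].
Qed.

(** * Maps from the interval and the square *)

Lemma clamp01_pf s : 0 <= clamp 0 1 s <= 1.
Proof. apply clamp_in; lra. Qed.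

Definition toI (s : R) : Isp := exist _ (clamp 0 1 s) (clamp01_pf s).

Lemma toI_proj (x : Isp) : toI (proj1_sig x) = x.
Proof. apply sig_ext. cbn. apply clamp_id. exact (proj2_sig x). Qed.

Lemma toI_lo s : s <= 0 -> toI s = I0.
Proof. intros h. apply sig_ext. cbn. apply clamp_lo; lra. Qed.

Lemma toI_hi s : 1 <= s -> toI s = I1.
Proof. intros h. apply sig_ext. cbn. apply clamp_hi; lra. Qed.

Lemma I_open_radius (U : Isp -> Prop) s : isopen Isp U -> U (toI s) ->
  exists d, 0 < d /\ forall s', Rabs (s' - s) < d -> U (toI s').
Proof.
  intros [V [hV E]] hs. apply E in hs. destruct (hV _ hs) as [d [hd h]].
  exists d; split; auto. intros s' hs'. apply E, h. cbn.
  eapply Rle_lt_trans; [apply clamp_contract; lra|exact hs'].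
Qed.

Lemma I_ball_open (x : Isp) d : isopen Isp (fun y : Isp => Rabs (proj1_sig y - proj1_sig x) < d).
Proof.
  exists (fun y => Rabs (y - proj1_sig x) < d). split; [|intros y; reflexivity].
  intros y hy. exists (d - Rabs (y - proj1_sig x)). split; [lra|]. intros z hz.
  replace (z - proj1_sig x) with ((z - y) + (y - proj1_sig x)) by ring.
  eapply Rle_lt_trans; [apply Rabs_triang|lra].
Qed.

Definition open_balls (Y : space) `{nearness Y} : Prop :=
  forall (y : Y) e, 0 < e -> isopen Y (fun z => nr e y z).

Lemma cont_I_cnt (Y : space) `{nearness Y} (a : Isp -> Y) :
  open_balls Y -> cont Isp Y a -> cnt (fun s => a (toI s)).
Proof.
  intros ob ha s e he.
  apply (I_open_radius (fun x => nr e (a (toI s)) (a x)) s (ha _ (ob (a (toI s)) e he))).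
  apply nr_refl; auto.
Qed.

Lemma cont_square_cnt (Y : space) `{nearness Y} (h : prodsp Isp Isp -> Y) :
  open_balls Y -> cont (prodsp Isp Isp) Y h -> cnt (fun p : R * R => h (toI (fst p), toI (snd p))).
Proof.
  intros ob hh [s t] e he. cbn [fst snd].
  destruct (hh _ (ob (h (toI s, toI t)) e he) (toI s, toI t)) as [U [V [hU [hV [h1 [h2 h3]]]]]].
  - apply nr_refl; auto.
  - destruct (I_open_radius U s hU h1) as [d [hd g]].
    destruct (I_open_radius V t hV h2) as [d' [hd' g']].
    exists (Rmin d d'). split; [apply Rmin_pos; auto|]. intros [s' t'] [g1 g2]. cbn in g1, g2.
    cbn [fst snd]. apply (h3 (toI s', toI t')); cbn [fst snd].
    + apply g. eapply Rlt_le_trans; [exact g1|apply Rmin_l].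
    + apply g'. eapply Rlt_le_trans; [exact g2|apply Rmin_r].
Qed.

(** Continuity at each point, tested on open sets of [Y]. It lies between [cnt] and [cont]; for J(H)
    it follows from [cnt] under a length bound. *)
Definition loc_open (Y : space) {X : Type} `{nearness X} (F : X -> Y) : Prop :=
  forall U x, isopen Y U -> U (F x) -> exists d, 0 < d /\ forall y, nr d x y -> U (F y).

Lemma loc_open_cont_I (Y : space) (F : R -> Y) :
  loc_open Y F -> cont Isp Y (fun x => F (proj1_sig x)).
Proof.
  intros hF U hU.
  exists (fun s => exists s0 d, Rabs (s - s0) < d /\ forall s', Rabs (s' - s0) < d -> U (F s')). split.
  - intros s [s0 [d [h1 h2]]]. exists (d - Rabs (s - s0)). split; [lra|].
    intros z hz. exists s0, d. split; auto.
    replace (z - s0) with ((z - s) + (s - s0)) by ring.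
    eapply Rle_lt_trans; [apply Rabs_triang|lra].
  - intros x. split.
    + intros hx. destruct (hF U (proj1_sig x) hU hx) as [d [hd h]].
      exists (proj1_sig x), d. split; auto. rewrite Rminus_diag, Rabs_R0; auto.
    + intros [s0 [d [h1 h2]]]. auto.
Qed.

Lemma loc_open_cont_square (Y : space) (F : R * R -> Y) :
  loc_open Y F -> cont (prodsp Isp Isp) Y (fun q => F (proj1_sig (fst q), proj1_sig (snd q))).
Proof.
  intros hF U hU p hp. destruct (hF U _ hU hp) as [d [hd h]].
  exists (fun y : Isp => Rabs (proj1_sig y - proj1_sig (fst p)) < d).
  exists (fun y : Isp => Rabs (proj1_sig y - proj1_sig (snd p)) < d).
  split; [apply I_ball_open|]. split; [apply I_ball_open|].
  rewrite !Rminus_diag, Rabs_R0. repeat (split; [auto|]).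
  intros q h1 h2. apply h. split; auto.
Qed.

Lemma loc_open_J {X} `{nearness X} (F : X -> word) n :
  cnt F -> (forall x, (length (F x) <= n)%nat) -> loc_open Jsp F.
Proof.
  intros hF hn U x hU hx. destruct (J_open_near U (F x) n hU hx) as [e [he h]].
  destruct (hF x e he) as [d [hd g]]. exists d; split; auto.
  intros y hy. apply h; [apply hn|exact (g y hy)].
Qed.

Lemma loc_open_T {X} `{nearness X} (F : X -> Tsp) :
  (forall k, cnt (fun x => F x k)) -> loc_open Tsp F.
Proof.
  intros hF W x hW hx. destruct (hW _ hx) as [m [U [h1 h2]]].
  assert (K : forall j, (j <= m)%nat -> exists d, 0 < d /\
     forall y, nr d x y -> forall i, (i < j)%nat -> U i (F y i)).
  { induction j as [|j IH]; intros hj; [exists 1; split; [lra|intros; lia]|].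
    destruct IH as [d [hd h]]; [lia|]. destruct (h1 j ltac:(lia)) as [g1 g2].
    destruct (S1_open_ball (U j) _ g1 g2) as [e [he g]].
    destruct (hF j x e he) as [d' [hd' h']].
    exists (Rmin d d'). split; [apply Rmin_pos; auto|]. intros y hy i hi.
    destruct (Nat.eq_dec i j) as [->|n].
    - apply g, h'. eapply nr_mono; [apply Rmin_r|exact hy].
    - apply h; [eapply nr_mono; [apply Rmin_l|exact hy]|lia]. }
  destruct (K m (le_n m)) as [d [hd h]]. exists d; split; auto.
Qed.

Lemma cont_coordinate k : cont Tsp S1sp (fun z => z k).
Proof.
  intros U hU z hz. exists (S k), (fun i => if Nat.eqb i k then U else fun _ => True). split.
  - intros i _. destruct (Nat.eqb i k) eqn:E.
    + apply Nat.eqb_eq in E as ->. auto.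
    + split; auto. exists (fun _ => True). split; [|tauto].
      intros p _. exists 1. split; [lra|auto].
  - intros z' h. specialize (h k (Nat.lt_succ_diag_r k)). rewrite Nat.eqb_refl in h. exact h.
Qed.

Lemma cont_comp (X Y Z : space) (F : X -> Y) (G : Y -> Z) :
  cont X Y F -> cont Y Z G -> cont X Z (fun x => G (F x)).
Proof. intros hF hG U hU. exact (hF _ (hG U hU)). Qed.

Lemma open_balls_J : open_balls Jsp (H := nearness_word).
Proof. intros w e he. apply near_ball_open; auto. Qed.

Lemma open_balls_S1 : open_balls S1sp.
Proof. intros z e _. apply S1_ball_open. Qed.

(** * Paths in J(H) have bounded length *)

(** Used to keep a neighbourhood of a word away from finitely many other words. *)
Lemma near_separated (u v : word) : (forall e, 0 < e -> near e u v) -> u = v.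
Proof.
  revert v. induction u as [|x u IH]; intros [|y v] h; auto.
  - destruct (not_small y) as [e [he n]]. specialize (h e he). apply near_nil_iff in h.
    inversion h; contradiction.
  - destruct (not_small x) as [e [he n]]. specialize (h e he). apply near_sym, near_nil_iff in h.
    inversion h; contradiction.
  - destruct (not_small x) as [e1 [he1 n1]]. destruct (not_small y) as [e2 [he2 n2]].
    assert (K : forall e, 0 < e -> nr e x y /\ near e u v).
    { intros e he. set (r := Rmin e (Rmin e1 e2)).
      assert (hr : 0 < r) by (unfold r; repeat apply Rmin_pos; auto).
      assert (r <= e) by apply Rmin_l.
      assert (r <= e1) by (eapply Rle_trans; [apply Rmin_r|apply Rmin_l]).
      assert (r <= e2) by (eapply Rle_trans; [apply Rmin_r|apply Rmin_r]).
      specialize (h r hr). inversion h; subst.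
      - exfalso. apply n1. eapply small_mono; eassumption.
      - exfalso. apply n2. eapply small_mono; eassumption.
      - split; [eapply nr_mono; eassumption|eapply near_mono; eassumption]. }
    f_equal; [|apply IH; intros e he; apply K; auto].
    assert (Z : forall a b : R, (forall e, 0 < e -> Rabs (b - a) < e) -> a = b).
    { intros a b hab. destruct (Req_dec a b) as [|ne]; auto. exfalso.
      apply (Rlt_irrefl (Rabs (b - a))). apply hab. apply Rabs_pos_lt. lra. }
    apply Hstar_ext, Hsp_ext, injective_projections; apply Z; intros e he; apply (K e he).
Qed.

(** Otherwise there are times tending to s at which the lengths grow without bound. Removing those
    values longer than [a s] leaves an open neighbourhood of [a s], contradicting continuity. *)
Lemma path_locally_bounded (a : Isp -> Jsp) s : cont Isp Jsp a ->
  exists d n, 0 < d /\ forall s', Rabs (s' - s) < d -> (length (a (toI s')) <= n)%nat.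
Proof.
  intros ha. apply NNPP. intro hn.
  assert (ex : forall i : nat, exists s', Rabs (s' - s) < / INR (S i) /\ (i < length (a (toI s')))%nat).
  { intros i. apply NNPP. intro h. apply hn. exists (/ INR (S i)), i.
    split; [apply Rinv_0_lt_compat, lt_0_INR; lia|].
    intros s' hs'. apply Nat.nlt_ge. intro l. apply h. exists s'. auto. }
  set (x := fun i => proj1_sig (constructive_indefinite_description _ (ex i))).
  assert (hx : forall i, Rabs (x i - s) < / INR (S i) /\ (i < length (a (toI (x i))))%nat).
  { intros i. exact (proj2_sig (constructive_indefinite_description _ (ex i))). }
  clearbody x.
  (* The [a (x i)] have unbounded length, so only finitely many lie in each J_n and they form
     a closed set. *)
  set (U := fun w : Jsp => forall i, (length (a (toI s)) < length (a (toI (x i))))%nat -> w <> a (toI (x i))).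
  assert (hU : isopen Jsp U).
  { apply J_open_intro. intros w n hw.
    (* The value at [x i] has more than i letters, so only indices i < n matter for words of length
       at most n. *)
    assert (K : forall j, exists e, 0 < e /\ forall w' : word, near e w w' -> forall i, (i < j)%nat ->
       (length (a (toI s)) < length (a (toI (x i))))%nat -> w' <> a (toI (x i))).
    { induction j as [|j [e [he IH]]]; [exists 1; split; [lra|intros; lia]|].
      destruct (classic (w = a (toI (x j)))) as [E|E].
      - exists e; split; auto. intros w' h i hi hl. destruct (Nat.eq_dec i j) as [->|ne].
        + destruct (hw j hl E).
        + apply IH; auto; lia.
      - assert (exists r, 0 < r /\ ~ near r w (a (toI (x j)))) as [r [hr nr']].
        { apply NNPP. intro hc. apply E, near_separated. intros r hr. apply NNPP. intro g.
          apply hc. exists r; auto. }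
        exists (Rmin e r). split; [apply Rmin_pos; auto|]. intros w' h i hi hl.
        destruct (Nat.eq_dec i j) as [->|ne].
        + intros ->. apply nr'. eapply near_mono; [apply Rmin_r|exact h].
        + apply IH; auto; [eapply near_mono; [apply Rmin_l|exact h]|lia]. }
    destruct (K n) as [e [he h]]. exists e; split; auto. intros w' hl hnear i hi E.
    apply (h w' hnear i) in hi; auto. rewrite E in hl. destruct (hx i). lia. }
  destruct (I_open_radius (fun y => U (a y)) s (ha U hU)) as [d [hd h]].
  { intros i hi E. rewrite E in hi. lia. }
  destruct (archimed_cor1 d hd) as [N [hN hN0]].
  set (i := Nat.max N (length (a (toI s)))).
  destruct (hx i) as [h1 h2].
  assert (h3 : / INR (S i) <= / INR N).
  { apply Rinv_le_contravar; [apply lt_0_INR; lia|apply le_INR; unfold i; lia]. }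
  apply (h (x i) ltac:(lra) i); auto. unfold i in *; lia.
Qed.

Lemma path_bounded (a : Isp -> Jsp) : cont Isp Jsp a ->
  exists n, forall s, (length (a (toI s)) <= n)%nat.
Proof.
  intros ha.
  assert (H : exists n, forall s, 0 <= s <= 1 -> (length (a (toI s)) <= n)%nat).
  { apply (interval_induction (fun u v => exists n, forall s, u <= s <= v -> (length (a (toI s)) <= n)%nat)).
    - intros u v w uv vw [n hn] [n' hn']. exists (Nat.max n n'). intros s hs.
      destruct (Rle_or_lt s v); [specialize (hn s ltac:(lra))|specialize (hn' s ltac:(lra))]; lia.
    - intros s _. destruct (path_locally_bounded a s ha) as [d [n [hd h]]]. exists d; split; auto.
      intros u v _ _ _ h1 h2. exists n. intros s' hs'. apply h, Rabs_def1; lra. }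
  destruct H as [n hn]. exists n. intros s.
  replace (toI s) with (toI (clamp 0 1 s)); [apply hn, clamp01_pf|].
  apply sig_ext. cbn. apply clamp_id, clamp01_pf.
Qed.

Lemma loop_word_loop (a : Isp -> Jsp) : isloop Jsp eJ a ->
  exists n, word_loop 0 n (fun s => a (toI s)).
Proof.
  intros [ha [h0 h1]]. destruct (path_bounded a ha) as [n hn]. exists n.
  split; [exact (cont_I_cnt Jsp (H := nearness_word) a open_balls_J ha)|]. split.
  - intros s [h|h]; [rewrite toI_lo by auto; exact h0|rewrite toI_hi by auto; exact h1].
  - intros s. split; [apply hn|]. intros x _. lia.
Qed.

(** * Winding numbers *)

Definition s1re (z w : S1sp) : R :=
  fst (proj1_sig z) * fst (proj1_sig w) + snd (proj1_sig z) * snd (proj1_sig w).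
Definition s1im (z w : S1sp) : R :=
  fst (proj1_sig z) * snd (proj1_sig w) - snd (proj1_sig z) * fst (proj1_sig w).

(* The angle, in turns, from [z] to [w] when it is less than a quarter; the maximum only
   serves to make the function continuous everywhere. *)
Definition angle_to (z w : S1sp) : R :=
  atan (s1im z w * / Rmax (s1re z w) (/ 2)) * / (2 * PI).

Lemma cnt_inv_ge {X} `{nearness X} (f : X -> R) : cnt f -> cnt (fun x => / Rmax (f x) (/ 2)).
Proof.
  intros hf x e he.
  assert (hg : cnt (fun x => Rmax (f x) (/ 2))) by cn.
  destruct (hg x (e / 4) ltac:(lra)) as [d [hd h]]. exists d; split; auto. intros y hy.
  specialize (h y hy). cbn in h |- *.
  pose proof (Rmax_r (f x) (/ 2)) as h1. pose proof (Rmax_r (f y) (/ 2)) as h2.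
  set (a := Rmax (f x) (/ 2)) in *. set (b := Rmax (f y) (/ 2)) in *.
  replace (/ b - / a) with (- ((b - a) * (/ a * / b))) by (field; lra).
  rewrite Rabs_Ropp, Rabs_mult.
  assert (i1 : 0 < / a <= 2).
  { split; [apply Rinv_0_lt_compat; lra|]. rewrite <- (Rinv_inv 2). apply Rinv_le_contravar; lra. }
  assert (i2 : 0 < / b <= 2).
  { split; [apply Rinv_0_lt_compat; lra|]. rewrite <- (Rinv_inv 2). apply Rinv_le_contravar; lra. }
  rewrite (Rabs_pos_eq (/ a * / b)) by nra. pose proof (Rabs_pos (b - a)).
  assert (/ a * / b <= 4) by nra. nra.
Qed.

Lemma cnt_angle_to {X} `{nearness X} (f g : X -> S1sp) :
  cnt f -> cnt g -> cnt (fun x => angle_to (f x) (g x)).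
Proof.
  intros hf hg.
  assert (cx : cnt (fun z : S1sp => fst (proj1_sig z))).
  { intros z e he. exists e; split; auto. intros w hw; apply hw. }
  assert (cy : cnt (fun z : S1sp => snd (proj1_sig z))).
  { intros z e he. exists e; split; auto. intros w hw; apply hw. }
  pose proof (cnt_comp f _ cx hf). pose proof (cnt_comp f _ cy hf).
  pose proof (cnt_comp g _ cx hg). pose proof (cnt_comp g _ cy hg).
  unfold angle_to. apply cnt_mult; [|apply cnt_const].
  apply (cnt_of_continuity atan).
  { intros x. apply derivable_continuous_pt, derivable_pt_atan. }
  apply cnt_mult; [unfold s1im; cn|]. apply cnt_inv_ge. unfold s1re; cn.
Qed.

Lemma cos_sin_atan c s : 0 < c -> c * c + s * s = 1 ->
  cos (atan (s * / c)) = c /\ sin (atan (s * / c)) = s.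
Proof.
  intros hc h.
  assert (E : sqrt (1 + (s * / c)²) = / c).
  { replace (1 + (s * / c)²) with ((/ c)²).
    - apply sqrt_Rsqr. left; apply Rinv_0_lt_compat; lra.
    - unfold Rsqr. transitivity ((c * c + s * s) * (/ c * / c)); [rewrite h; ring|field; lra]. }
  rewrite cos_atan, sin_atan, E. split; field; lra.
Qed.

Lemma S1_norm (z : S1sp) : fst (proj1_sig z) * fst (proj1_sig z) + snd (proj1_sig z) * snd (proj1_sig z) = 1.
Proof. destruct z as [[x y] h]. unfold onS1 in h. cbn in *. lra. Qed.

Lemma ee_angle_to (z w : S1sp) th : z = ee th -> nr (/ 2) z w -> w = ee (th + angle_to z w).
Proof.
  intros hz [h1 h2].
  change (Rabs (fst (proj1_sig w) - fst (proj1_sig z)) < / 2) in h1.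
  change (Rabs (snd (proj1_sig w) - snd (proj1_sig z)) < / 2) in h2.
  apply Rabs_def2 in h1, h2.
  pose proof (S1_norm z) as nz. pose proof (S1_norm w) as nw.
  assert (zx : fst (proj1_sig z) = cos (2 * PI * th)) by (rewrite hz; reflexivity).
  assert (zy : snd (proj1_sig z) = sin (2 * PI * th)) by (rewrite hz; reflexivity).
  (* The squared distance of z and w is 2 - 2 * [s1re z w] and is below 1/2, so the maximum in
     [angle_to] is attained by [s1re]. *)
  assert (hre : / 2 < s1re z w).
  { assert (K : forall d, - / 2 < d < / 2 -> d * d < / 4) by (intros d hd; nra).
    pose proof (K _ (conj (proj2 h1) (proj1 h1))). pose proof (K _ (conj (proj2 h2) (proj1 h2))).
    unfold s1re. lra. }
  assert (hn : s1re z w * s1re z w + s1im z w * s1im z w = 1).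
  { unfold s1re, s1im. rewrite <- (Rmult_1_r 1), <- nz at 1. rewrite <- nw. ring. }
  destruct (cos_sin_atan (s1re z w) (s1im z w) ltac:(lra) hn) as [e1 e2].
  pose proof PI_RGT_0.
  assert (E : 2 * PI * angle_to z w = atan (s1im z w * / s1re z w)).
  { unfold angle_to. rewrite Rmax_left by lra. field. lra. }
  apply S1_ext. cbn [proj1_sig ee]. unfold circ.
  rewrite Rmult_plus_distr_l, cos_plus, sin_plus, E, e1, e2, <- zx, <- zy.
  unfold s1re, s1im. apply injective_projections; cbn [fst snd].
  - transitivity ((fst (proj1_sig z) * fst (proj1_sig z) + snd (proj1_sig z) * snd (proj1_sig z)) * fst (proj1_sig w)); [rewrite nz; ring|ring].
  - transitivity ((fst (proj1_sig z) * fst (proj1_sig z) + snd (proj1_sig z) * snd (proj1_sig z)) * snd (proj1_sig w)); [rewrite nz; ring|ring].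
Qed.

Lemma angle_to_self z : angle_to z z = 0.
Proof.
  unfold angle_to. replace (s1im z z) with 0 by (unfold s1im; ring).
  rewrite Rmult_0_l, atan_0. ring.
Qed.

Lemma ee_eq_zint a b : ee a = ee b -> zint (a - b).
Proof.
  intros h. assert (E : circ a = circ b) by exact (f_equal (@proj1_sig _ _) h).
  injection E; intros e1 e2. apply zint_cos.
  rewrite Rmult_minus_distr_l, cos_minus, e1, e2. apply cos2_sin2.
Qed.

Lemma ee_add_zint a m : zint m -> ee (a + m) = ee a.
Proof. intros h. apply S1_ext. cbn. apply circ_add_zint, h. Qed.

Lemma ee_zint m : zint m -> ee m = s1one.
Proof. intros [h1 h2]. apply S1_ext. cbn. unfold circ. rewrite h1, h2. reflexivity. Qed.

Lemma zint_small x : zint x -> Rabs x < 1 / 2 -> x = 0.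
Proof.
  intros [h _] hx. destruct (Req_dec x 0) as [|n]; auto. exfalso.
  pose proof PI_RGT_0. pose proof (Rabs_pos_lt x n) as h0.
  assert (h' : cos (2 * PI * Rabs x) = 1).
  { unfold Rabs; destruct (Rcase_abs x); auto.
    rewrite Ropp_mult_distr_r_reverse, cos_neg; auto. }
  pose proof (cos_lt_1 (2 * PI * Rabs x) ltac:(nra)). lra.
Qed.

(** The difference of two lifts is continuous with integer values, hence constant. *)
Lemma lift_unique (th th' : R -> R) : cnt th -> cnt th' ->
  (forall s, 0 <= s <= 1 -> ee (th s) = ee (th' s)) -> th 1 - th 0 = th' 1 - th' 0.
Proof.
  intros h h' E.
  enough (th 0 - th' 0 = th 1 - th' 1) by lra.
  apply (interval_induction (fun u v => th u - th' u = th v - th' v)).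
  - intros u v w _ _ e1 e2. congruence.
  - intros s hs.
    assert (hd : cnt (fun s => th s - th' s)) by cn.
    destruct (hd s (1 / 4) ltac:(lra)) as [d [hd0 g]]. exists d; split; auto.
    intros u v uv hu hv h1 h2. apply Rminus_diag_uniq, zint_small.
    + apply zint_sub; apply ee_eq_zint, E; lra.
    + pose proof (g u) as gu. pose proof (g v) as gv. cbn in gu, gv.
      specialize (gu ltac:(apply Rabs_def1; lra)). specialize (gv ltac:(apply Rabs_def1; lra)).
      apply Rabs_def2 in gu, gv. apply Rabs_def1; lra.
Qed.

Lemma lift_exists (g : R -> S1sp) : cnt g ->
  exists th, cnt th /\ forall s, 0 <= s <= 1 -> g s = ee (th s).
Proof.
  intros hg.
  apply (interval_induction (fun u v => exists th, cnt th /\ forall s, u <= s <= v -> g s = ee (th s))).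
  - intros u v w uv vw [th [h1 h2]] [th' [h1' h2']].
    assert (hc : zint (th v - th' v)).
    { apply ee_eq_zint. rewrite <- h2, <- h2'; auto; lra. }
    exists (fun s => if Rle_dec (s - v) 0 then th s else th' s + (th v - th' v)). split.
    + apply cnt_paste; [cn|cn|cn|]. intros s e. replace s with v by lra. ring.
    + intros s hs. destruct (Rle_dec _ _); [apply h2; lra|].
      rewrite ee_add_zint by auto. apply h2'; lra.
  - intros s _. destruct (hg s (/ 2) ltac:(lra)) as [d [hd h]]. exists d; split; auto.
    intros u v uv _ _ h1 h2.
    destruct (angle_exists _ _ (S1_norm (g s))) as [t0 [_ E]].
    assert (E' : g s = ee t0).
    { apply S1_ext. cbn. rewrite E. apply surjective_pairing. }
    exists (fun r => t0 + angle_to (g s) (g r)). split.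
    + apply cnt_plus; [cn|]. apply cnt_angle_to; cn.
    + intros r hr. apply ee_angle_to; auto. apply h. cbn. apply Rabs_def1; lra.
Qed.

Lemma nr_S1_trans d e (x y z : S1sp) : nr d x y -> nr e y z -> nr (d + e) x z.
Proof.
  intros [h1 h2] [h3 h4]. cbn in *.
  apply Rabs_def2 in h1, h2, h3, h4. split; cbn; apply Rabs_def1; lra.
Qed.

Lemma nr_S1_sym e (x y : S1sp) : nr e x y -> nr e y x.
Proof. intros [h1 h2]. cbn in *. rewrite Rabs_minus_sym in h1, h2. split; auto. Qed.

Lemma tube (h : R * R -> S1sp) t0 e : cnt h -> 0 < e ->
  exists d, 0 < d /\ forall t s, Rabs (t - t0) < d -> 0 <= s <= 1 -> nr e (h (s, t0)) (h (s, t)).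
Proof.
  intros hh he.
  apply (interval_induction (fun u v => exists d, 0 < d /\
    forall t s, Rabs (t - t0) < d -> u <= s <= v -> nr e (h (s, t0)) (h (s, t)))).
  - intros u v w uv vw [d [hd H]] [d' [hd' H']]. exists (Rmin d d').
    split; [apply Rmin_pos; auto|]. intros t s ht hs.
    destruct (Rle_or_lt s v); [apply H|apply H']; try lra.
    + eapply Rlt_le_trans; [exact ht|apply Rmin_l].
    + eapply Rlt_le_trans; [exact ht|apply Rmin_r].
  - intros s0 _. destruct (hh (s0, t0) (e / 2) ltac:(lra)) as [d [hd g]]. exists d; split; auto.
    intros u v uv _ _ h1 h2. exists d; split; auto. intros t s ht hs.
    replace e with (e / 2 + e / 2) by field. apply nr_S1_trans with (h (s0, t0)).
    + apply nr_S1_sym, g. split; cbn; apply Rabs_def1; lra.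
    + apply g. split; cbn; [apply Rabs_def1; lra|auto].
Qed.

(** Homotopy invariance of the winding number without lifting the square: over a short time the lift
    is corrected by [angle_to], and the correction vanishes at both ends, where [h] is constant. *)
Lemma lift_transfer (h : R * R -> S1sp) : cnt h ->
  (forall t, h (0, t) = s1one /\ h (1, t) = s1one) ->
  forall th, cnt th -> (forall s, 0 <= s <= 1 -> h (s, 0) = ee (th s)) ->
  exists th', cnt th' /\ (forall s, 0 <= s <= 1 -> h (s, 1) = ee (th' s)) /\
    th' 1 - th' 0 = th 1 - th 0.
Proof.
  intros hh side.
  apply (interval_induction (fun t1 t2 => forall th, cnt th ->
    (forall s, 0 <= s <= 1 -> h (s, t1) = ee (th s)) ->
    exists th', cnt th' /\ (forall s, 0 <= s <= 1 -> h (s, t2) = ee (th' s)) /\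
    th' 1 - th' 0 = th 1 - th 0)).
  - intros u v w _ _ h1 h2 th c e. destruct (h1 th c e) as [th1 [c1 [e1 d1]]].
    destruct (h2 th1 c1 e1) as [th2 [c2 [e2 d2]]]. exists th2. repeat (split; auto). lra.
  (* Two comparisons within 1/4 give the distance 1/2 allowed by [ee_angle_to]. *)
  - intros t0 _. destruct (tube h t0 (/ 4) hh ltac:(lra)) as [d [hd g]]. exists d; split; auto.
    intros u v uv _ _ hu hv th c e.
    exists (fun s => th s + angle_to (h (s, u)) (h (s, v))). split; [|split].
    + apply cnt_plus; auto. apply cnt_angle_to.
      * apply (cnt_comp (fun s => (s, u)) h); auto. cn.
      * apply (cnt_comp (fun s => (s, v)) h); auto. cn.
    + intros s hs. apply ee_angle_to; auto.
      replace (/ 2) with (/ 4 + / 4) by field. apply nr_S1_trans with (h (s, t0)).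
      * apply nr_S1_sym, g; auto. apply Rabs_def1; lra.
      * apply g; auto. apply Rabs_def1; lra.
    + destruct (side u) as [-> ->], (side v) as [-> ->]. rewrite angle_to_self. ring.
Qed.

(** * The homomorphism on words *)

Lemma s1mul_one_l z : s1mul s1one z = z.
Proof. apply S1_ext. destruct z as [[x y] h]; cbn. f_equal; ring. Qed.

Lemma etaH_pt j th k : etaH (pt j th) k = if Nat.eqb j k then ee th else s1one.
Proof.
  pose proof (INR_rad k) as hr. unfold etaH.
  destruct (Req_EM_T _ _) as [h|h].
  - apply S1_ext. cbn [proj1_sig].
    destruct (Nat.eqb j k) eqn:E.
    + apply Nat.eqb_eq in E as ->. cbn [proj1_sig ee]. unfold circ, pt, ptR. cbn [proj1_sig fst snd].
      f_equal.
      * transitivity (1 - (INR (S k) * rad k) * (1 - cos (2 * PI * th))); [ring|rewrite hr; ring].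
      * transitivity ((INR (S k) * rad k) * sin (2 * PI * th)); [ring|rewrite hr; ring].
    + destruct (sigmaJ_cases (pt j th)) as [e|[x e]].
      * rewrite e. cbn. f_equal; ring.
      * exfalso. apply Nat.eqb_neq in E. apply E.
        rewrite <- (idx_unique j x), <- (idx_unique k x); auto.
        -- rewrite e. exact h.
        -- rewrite e. apply ptR_on.
  - destruct (Nat.eqb j k) eqn:E; auto. apply Nat.eqb_eq in E as ->.
    exfalso. apply h. exact (ptR_on k th).
Qed.

Section Hom.
Variable f : Jsp -> Tsp.
Hypothesis f_cont : cont Jsp Tsp f.
Hypothesis f_nil : f nil = x0.
Hypothesis f_app : forall u v : Jsp, f (u ++ v) = tmul (f u) (f v).
Hypothesis f_sigma : forall x : Hsp, f (sigmaJ x) = etaH x.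

Lemma f_P j th k : f (P j th) k = if Nat.eqb j k then ee th else s1one.
Proof. unfold P. rewrite f_sigma. apply etaH_pt. Qed.

Lemma f_letter x k : f [x] k = if Nat.eqb (idx x) k then ee (ang x) else s1one.
Proof. rewrite <- P_coords. apply f_P. Qed.

Lemma f_cons x (w : word) k : f (x :: w) k = s1mul (f [x] k) (f w k).
Proof. change (x :: w) with ([x] ++ w). rewrite f_app. reflexivity. Qed.

Lemma f_del_same k w : f (del k w) k = s1one.
Proof.
  induction w as [|x w IH]; [cbn; rewrite f_nil; reflexivity|].
  unfold del. cbn [filter]. fold (del k w). destruct (Nat.eqb (idx x) k) eqn:E; cbn [negb]; auto.
  rewrite f_cons, f_letter, E, IH. apply s1mul_one_l.
Qed.

Lemma f_del_other j k w : j <> k -> f (del j w) k = f w k.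
Proof.
  intros n. induction w as [|x w IH]; auto.
  unfold del. cbn [filter]. fold (del j w). rewrite (f_cons x w).
  destruct (Nat.eqb (idx x) j) eqn:E; cbn [negb].
  - rewrite f_letter. apply Nat.eqb_eq in E. rewrite E. apply Nat.eqb_neq in n. rewrite n, IH.
    symmetry. apply s1mul_one_l.
  - rewrite f_cons, IH. reflexivity.
Qed.

Lemma f_delete_below j k w : (j <= k)%nat -> f (delete_below j w) k = f w k.
Proof.
  induction j as [|j IH]; intros h; auto. cbn [delete_below].
  rewrite f_del_other by lia. apply IH; lia.
Qed.

(** [f] is continuous for the given topologies only, so [F] is first regarded as a map from the
    square to J(H), which is where the length bound enters; returning to the plane introduces the
    clamps. *)
Lemma cnt_f_coordinate (F : R * R -> word) n k : cnt F -> (forall p, (length (F p) <= n)%nat) ->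
  cnt (fun p : R * R => f (F (clamp 0 1 (fst p), clamp 0 1 (snd p))) k).
Proof.
  intros hF hn.
  apply (cont_square_cnt S1sp (fun q : prodsp Isp Isp => f (F (proj1_sig (fst q), proj1_sig (snd q))) k) open_balls_S1).
  apply (cont_comp _ Tsp _ (fun q : prodsp Isp Isp => f (F (proj1_sig (fst q), proj1_sig (snd q)))) (fun z => z k));
    [|apply cont_coordinate].
  apply (cont_comp _ Jsp _ (fun q : prodsp Isp Isp => F (proj1_sig (fst q), proj1_sig (snd q))) f); auto.
  apply loc_open_cont_square. apply (loc_open_J F n); auto.
Qed.

Lemma f_then_loop k m (b : R -> word) s : zint m ->
  f (then_loop k m (fun s => del k (b s)) s) k = ee (m * clamp 0 1 (2 * s)).
Proof.
  intros hm. unfold then_loop. destruct (Rle_dec _ _).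
  - unfold turns. rewrite f_P, Nat.eqb_refl. reflexivity.
  - rewrite f_del_same, clamp_hi, Rmult_1_r by lra. symmetry. apply ee_zint, hm.
Qed.

(** Factor k does not see the deletion of earlier circles, and after the peeling it sees only the
    [m] turns. Transporting the lift along the peeling compares the two. *)
Lemma winding_of_normal_form n a k m H : word_loop 0 n a -> zint m ->
  word_homotopy k (split_bound n) (fun s => delete_below k (a s))
        (then_loop k m (fun s => delete_below (S k) (a s))) H ->
  forall th, cnt th -> (forall s, 0 <= s <= 1 -> f (a s) k = ee (th s)) -> th 1 - th 0 = m.
Proof.
  intros ha hm [hH h] th hth E.
  destruct (lift_transfer (fun p => f (H (clamp 0 1 (fst p), clamp 0 1 (snd p))) k)) with (th := th)
    as [th' [c' [E' d']]]; auto.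
  - apply cnt_f_coordinate with (split_bound n); auto. intros [s t]. apply (h s t).
  - intros t. cbn [fst snd].
    assert (K : forall s, outside s -> f (H (s, clamp 0 1 t)) k = s1one).
    { intros s hs. destruct (h s (clamp 0 1 t)) as [_ [_ [-> _]]]; auto. rewrite f_nil. reflexivity. }
    split; apply K; unfold outside; [rewrite clamp_lo; lra|rewrite clamp_hi; lra].
  - intros s hs. cbn [fst snd]. rewrite (clamp_id 0 1 s), (clamp_lo 0 1 0) by lra.
    destruct (h s 0) as [-> _]; [|lra]. rewrite f_delete_below by lia. auto.
  - rewrite <- d'.
    rewrite (lift_unique th' (fun s => m * clamp 0 1 (2 * s))); auto.
    + rewrite (clamp_hi 0 1 (2 * 1)), (clamp_lo 0 1 (2 * 0)) by lra. ring.
    + cn.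
    + intros s hs. rewrite <- E' by auto. cbn [fst snd]. rewrite (clamp_id 0 1 s), (clamp_hi 0 1 1) by lra.
      destruct (h s 1) as [_ [-> _]]; [|lra]. cbn [delete_below]. apply f_then_loop; auto.
Qed.

Lemma f_path_cnt (a : Isp -> Jsp) k : cont Isp Jsp a -> cnt (fun s => f (a (toI s)) k).
Proof.
  intros ha. apply (cont_I_cnt S1sp (fun x => f (a x) k) open_balls_S1).
  apply (cont_comp _ Tsp _ (fun x => f (a x)) (fun z => z k)); [|apply cont_coordinate].
  apply (cont_comp _ Jsp _ a f); auto.
Qed.

Lemma f_injective (a a' : Isp -> Jsp) : isloop Jsp eJ a -> isloop Jsp eJ a' ->
  homotopic Tsp x0 (fun s => f (a s)) (fun s => f (a' s)) -> homotopic Jsp eJ a a'.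
Proof.
  intros la la' [Hm [hHm hom]].
  destruct (loop_word_loop a la) as [n wa]. destruct (loop_word_loop a' la') as [n' wa'].
  destruct (word_loop_normal_form n _ wa) as [m [hm [hH hG]]].
  destruct (word_loop_normal_form n' _ wa') as [m' [hm' [hH' hG']]].
  assert (E : m = m').
  (* A lift of factor k for [a] is transported along the given homotopy in T to a lift for [a'] with
     the same net change. *)
  { apply functional_extensionality. intros k.
    destruct (lift_exists _ (f_path_cnt a k (proj1 la))) as [th [c e]].
    destruct (hH k) as [H hk]. destruct (hH' k) as [H' hk'].
    rewrite <- (winding_of_normal_form n _ k (m k) H wa (hm k) hk th c e).
    destruct (lift_transfer (fun p : R * R => Hm (toI (fst p), toI (snd p)) k)) with (th := th)
      as [th' [c' [e' d']]]; auto.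
    - apply (cont_square_cnt S1sp (fun q => Hm q k) open_balls_S1).
      apply (cont_comp _ Tsp _ Hm (fun z => z k)); auto. apply cont_coordinate.
    - intros t. cbn [fst snd]. rewrite (toI_lo 0), (toI_hi 1) by lra.
      destruct (hom I0 (toI t)) as [_ [_ [-> ->]]]. split; reflexivity.
    - intros s hs. cbn [fst snd]. rewrite (toI_lo 0) by lra.
      destruct (hom (toI s) I0) as [-> _]. auto.
    - rewrite <- (winding_of_normal_form n' _ k (m' k) H' wa' (hm' k) hk' th' c'); auto.
      intros s hs. rewrite <- e' by auto. cbn [fst snd]. rewrite (toI_hi 1) by lra.
      destruct (hom (toI s) I0) as [_ [-> _]]. reflexivity. }
  subst m'. destruct (spiral_exists m hm) as [L [hL wL]].
  destruct (hG L hL) as [G [cG g]]. destruct (hG' L hL) as [G' [cG' g']].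
  (* Both loops are deformed to the same spiral; the second deformation is run backwards. *)
  set (F := fun p : R * R => if Rle_dec (snd p - / 2) 0 then G (fst p, 2 * snd p)
                             else G' (fst p, 2 - 2 * snd p)).
  assert (cF : cnt F).
  { unfold F. apply cnt_paste; [cn|cn|cn|]. intros [s t] e. cbn [fst snd] in *.
    destruct (g s (2 * t)) as [_ [-> _]]; [|lra].
    destruct (g' s (2 - 2 * t)) as [_ [-> _]]; [|lra]. reflexivity. }
  set (N := Nat.max (split_bound n) (split_bound n')).
  exists (fun q => F (proj1_sig (fst q), proj1_sig (snd q))). split.
  - apply loc_open_cont_square. apply (loc_open_J F N); auto.
    intros [s t]. unfold F, N. cbn [fst snd].
    destruct (Rle_dec _ _).
    + destruct (g s (2 * t)) as [_ [_ [_ [l _]]]].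
      eapply Nat.le_trans; [exact l|apply Nat.le_max_l].
    + destruct (g' s (2 - 2 * t)) as [_ [_ [_ [l _]]]].
      eapply Nat.le_trans; [exact l|apply Nat.le_max_r].
  - intros s t. unfold F. cbn [fst snd].
    assert (side : forall x t0, outside x -> (if Rle_dec (t0 - / 2) 0 then G (x, 2 * t0) else G' (x, 2 - 2 * t0)) = eJ).
    { intros x t0 hx. destruct (Rle_dec _ _); [apply g|apply g']; auto. }
    split; [|split; [|split]].
    + change (proj1_sig I0) with 0. destruct (Rle_dec _ _); [|lra].
      transitivity (a (toI (proj1_sig s))); [apply g; lra|exact (f_equal a (toI_proj s))].
    + change (proj1_sig I1) with 1. destruct (Rle_dec _ _); [lra|].
      transitivity (a' (toI (proj1_sig s))); [apply g'; lra|exact (f_equal a' (toI_proj s))].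
    + apply side. left. cbn. lra.
    + apply side. right. cbn. lra.
Qed.

(* The affine map carrying the [d]-th stage of the spiral onto [0,1/2]. *)
Fixpoint zoom (d : nat) (s : R) : R :=
  match d with O => s | S d => zoom d (2 * s - 1) end.

Lemma zoom_nonpos d s : s <= 0 -> zoom d s <= 0.
Proof. revert s. induction d as [|d IH]; intros s h; cbn; auto. apply IH; lra. Qed.

Lemma zoom_1 d : zoom d 1 = 1.
Proof. induction d as [|d IH]; cbn; auto. replace (2 * 1 - 1) with 1 by ring. exact IH. Qed.

Lemma cnt_zoom d : cnt (zoom d).
Proof.
  induction d as [|d IH]; cbn [zoom]; [apply cnt_id|].
  apply (cnt_comp (fun s => 2 * s - 1) (zoom d)); auto. cn.
Qed.

Lemma f_spiral_stage_other m j b k s : (k < b)%nat -> f (spiral_stage m j b s) k = s1one.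
Proof.
  revert b s. induction j as [|j IH]; intros b s h; cbn [spiral_stage]; [rewrite f_nil; reflexivity|].
  unfold then_loop. destruct (Rle_dec _ _); [|apply IH; lia].
  unfold turns. rewrite f_P. destruct (Nat.eqb_spec b k); auto; lia.
Qed.

(** Before its own piece [zoom d s] is nonpositive, and after it the clamp is saturated at an
    integer multiple of a turn, so one formula covers all times. *)
Lemma f_spiral_stage m d i b s : (forall k, zint (m k)) ->
  f (spiral_stage m (S d + i) b s) (b + d)%nat = ee (m (b + d)%nat * clamp 0 1 (2 * zoom d s)).
Proof.
  intros hm. revert b s. induction d as [|d IH]; intros b s.
  - rewrite Nat.add_0_r. cbn [spiral_stage Nat.add zoom]. unfold then_loop. destruct (Rle_dec _ _).
    + unfold turns. rewrite f_P, Nat.eqb_refl. reflexivity.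
    + rewrite f_spiral_stage_other, clamp_hi, Rmult_1_r by (lia || lra). symmetry. apply ee_zint, hm.
  - change (S (S d) + i)%nat with (S (S d + i)). cbn [spiral_stage zoom]. unfold then_loop.
    destruct (Rle_dec _ _).
    + unfold turns. rewrite f_P. destruct (Nat.eqb_spec b (b + S d)); [lia|].
      pose proof (zoom_nonpos d (2 * s - 1) ltac:(lra)).
      rewrite clamp_lo, Rmult_0_r by lra. symmetry. apply ee_zint, zint_0.
    + replace (b + S d)%nat with (S b + d)%nat by lia. apply IH.
Qed.

Lemma f_spiral m L k s : (forall k, zint (m k)) -> spiral m L ->
  f (L s) k = ee (m k * clamp 0 1 (2 * zoom k s)).
Proof.
  intros hm hL. destruct (hL s) as [j0 E]. rewrite <- (E (S k)).
  replace (j0 + S k)%nat with (S k + j0)%nat by lia.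
  apply (f_spiral_stage m k j0 0 s hm).
Qed.

(** Lifts with the same ends are joined linearly in each factor. The product topology requires no
    uniformity in k, so these homotopies together form one in T. *)
Lemma f_surjective (g : Isp -> Tsp) : isloop Tsp x0 g ->
  exists a : Isp -> Jsp, isloop Jsp eJ a /\ homotopic Tsp x0 (fun s => f (a s)) g.
Proof.
  intros [cg [g0 g1]].
  assert (ex : forall k, exists th, cnt th /\ th 0 = 0 /\
     forall s, 0 <= s <= 1 -> g (toI s) k = ee (th s)).
  { intros k. destruct (lift_exists (fun s => g (toI s) k)) as [th [c e]].
    - apply (cont_I_cnt S1sp (fun x => g x k) open_balls_S1).
      apply (cont_comp _ Tsp _ g (fun z => z k)); auto. apply cont_coordinate.
    - assert (z : zint (- th 0)).
      { replace (- th 0) with (0 - th 0) by ring. apply ee_eq_zint.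
        rewrite <- e by lra. rewrite toI_lo, g0 by lra. apply ee_zint, zint_0. }
      exists (fun s => th s + - th 0). split; [cn|]. split; [ring|].
      intros s hs. rewrite ee_add_zint; auto. }
  set (th := fun k => proj1_sig (constructive_indefinite_description _ (ex k))).
  assert (hth : forall k, cnt (th k) /\ th k 0 = 0 /\
     forall s, 0 <= s <= 1 -> g (toI s) k = ee (th k s)).
  { intros k. exact (proj2_sig (constructive_indefinite_description _ (ex k))). }
  clearbody th.
  set (m := fun k => th k 1).
  assert (hm : forall k, zint (m k)).
  { intros k. replace (m k) with (m k - 0) by ring. apply ee_eq_zint. unfold m.
    destruct (hth k) as [_ [_ e]]. rewrite <- e by lra. rewrite toI_hi, g1 by lra.
    symmetry. apply ee_zint, zint_0. }
  destruct (spiral_exists m hm) as [L [hL [cL [oL tL]]]].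
  exists (fun x => L (proj1_sig x)). split.
  { split; [|split].
    - apply loc_open_cont_I. apply (loc_open_J L 1); auto. intros s. apply tL.
    - apply oL. left. cbn. lra.
    - apply oL. right. cbn. lra. }
  set (lam := fun k s => m k * clamp 0 1 (2 * zoom k s)).
  assert (clam : forall k, cnt (lam k)).
  { intros k. pose proof (cnt_zoom k). unfold lam. cn. }
  assert (lam0 : forall k, lam k 0 = 0).
  { intros k. unfold lam. pose proof (zoom_nonpos k 0 ltac:(lra)). rewrite clamp_lo by lra. ring. }
  assert (lam1 : forall k, lam k 1 = m k).
  { intros k. unfold lam. rewrite zoom_1, clamp_hi by lra. ring. }
  set (F := fun (p : R * R) (k : nat) => ee ((1 - snd p) * lam k (fst p) + snd p * th k (fst p))).
  exists (fun q => F (proj1_sig (fst q), proj1_sig (snd q))). split.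
  - apply loc_open_cont_square. apply (loc_open_T (F : R * R -> Tsp)). intros k.
    pose proof (cnt_zoom k). destruct (hth k) as [ck _]. apply cnt_ee. unfold lam. cn.
  - intros s t. unfold F. cbn [fst snd]. pose proof (proj2_sig s) as hs.
    split; [|split; [|split]]; apply functional_extensionality; intros k.
    + transitivity (ee (lam k (proj1_sig s))); [|symmetry; apply (f_spiral m L k _ hm hL)].
      apply (f_equal ee). change (proj1_sig I0) with 0. rewrite Rmult_0_l, Rplus_0_r, Rminus_0_r.
      apply Rmult_1_l.
    + transitivity (ee (th k (proj1_sig s))).
      * apply (f_equal ee). change (proj1_sig I1) with 1.
        rewrite Rminus_diag, Rmult_0_l, Rplus_0_l. apply Rmult_1_l.
      * destruct (hth k) as [_ [_ e]]. rewrite <- (e _ hs). exact (f_equal (fun x => g x k) (toI_proj s)).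
    + change (proj1_sig I0) with 0. destruct (hth k) as [_ [e _]]. rewrite lam0, e.
      unfold x0. apply ee_zint. match goal with |- zint ?x => replace x with 0 by ring end. apply zint_0.
    + change (proj1_sig I1) with 1. rewrite lam1. fold (m k).
      unfold x0. apply ee_zint. match goal with |- zint ?x => replace x with (m k) by ring end. apply hm.
Qed.

End Hom.

(* For the (unique) continuous monoid homomorphism f = etaH~ : J(H) -> T with
   f o sigmaJ = etaH, the induced map f_# : pi_1(J(H), b0) -> pi_1(T, x0),
   [a] |-> [f o a], is bijective (it is automatically a homomorphism). *)
Theorem mainTheorem19 :
  forall f : Jsp -> Tsp,
    cont Jsp Tsp f ->
    f nil = x0 ->
    (forall u v : Jsp, f (u ++ v) = tmul (f u) (f v)) ->
    (forall x : Hsp, f (sigmaJ x) = etaH x) ->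
    (* f_# injective *)
    (forall a a' : Isp -> Jsp, isloop Jsp eJ a -> isloop Jsp eJ a' ->
       homotopic Tsp x0 (fun s => f (a s)) (fun s => f (a' s)) ->
       homotopic Jsp eJ a a') /\
    (* f_# surjective *)
    (forall g : Isp -> Tsp, isloop Tsp x0 g ->
       exists a : Isp -> Jsp, isloop Jsp eJ a /\
         homotopic Tsp x0 (fun s => f (a s)) g).
Proof.
  intros f f_cont f_nil f_app f_sigma. split.
  - apply f_injective; assumption.
  - apply f_surjective; assumption.
Qed.
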